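(* For a finitely supported value distribution $\mathcal{D}$ and number of buyers $n$, let $P$ denote the set of all tuples $(x,y,u)$ that are $n$-buyer auction feasible via repeated auctions whose bid space is equal to the support of $\mathcal{D}$. Then $P$ is not necessarily convex, even when $n=2$; that is, there is a distribution $\mathcal{D}$ for which, with $n=2$, the set $P$ is not convex.
   Context: Setting. There are $n$ buyers and $T$ rounds, one item per round; buyer $i$'s value $v_{it}$ in round $t$ is drawn independently from $\mathcal{D}$, with support $w_1<\dots<w_m$, $\Pr[w_j]=q_j$. Asymptotics are for $T\to\infty$ with $n,\mathcal{D}$ fixed. A repeated auction consists of a finite set of arms (the same for all buyers and rounds) labelled by nonnegative bids (besides a non-participation arm labelled $0$), and for each round $t$ and vector $\vec b$ of arms an allocation probability $a_{it}(\vec b)\in[0,1]$ and a price $p_{it}(\vec b)\in[0,b_i a_{it}(\vec b)]$ for each buyer $i$, with $\sum_i a_{it}(\vec b)\le1$, invariance under permuting buyers, and $a_{it}(b_i;\vec b_{-i})$, $p_{it}(b_i;\vec b_{-i})$ nondecreasing in $b_i$. The bid space is equal to the support of $\mathcal{D}$ when the (participating) arm labels are exactly $w_1,\dots,w_m$. Strategies. A strategy $S_i$ maps the value $v_{it}$ and the past observations to a (possibly random) arm $b^{S_i}_{it}(v_{it})$. Let $r_{ibt}(v)=v\,a_{it}(b;\vec b_{-i,t})-p_{it}(b;\vec b_{-i,t})$ and $\sigma_{i,b,s}(v)=\sum_{t<s}r_{ibt}(v)$. A clever $\gamma$-mean-based strategy is one that (i) never pulls an arm with label exceeding the current value; (ii)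 among the arms $b,b'\le v_{i,s}$: whenever $\sigma_{i,b,s}(v_{i,s})<\sigma_{i,b',s}(v_{i,s})-\gamma T$, arm $b$ is pulled in round $s$ with probability at most $\gamma$; (iii) is no-regret among non-overbidding bids: its expected total utility is within $o(T)$ of that of every strategy that bids a fixed function of the current value not exceeding that value, for every fixed sequence of auctions and fixed bids of the others. Averages (expectation over all values and randomness): $X^A_{ij}=\frac1T\mathbb{E}\big[\sum_t a_{it}(b^{S_i}_{it}(w_j);b^{S_{-i}}_{-it}(v_{-it}))\big]$, $Y^A_{ij}=\frac1T\mathbb{E}\big[\sum_t a_{it}(w_j;b^{S_{-i}}_{-it}(v_{-it}))\big]$, $U^A_{ij}=\frac1T\mathbb{E}\big[\sum_t w_j a_{it}(b^{S_i}_{it}(w_j);b^{S_{-i}}_{-it}(v_{-it}))-p_{it}(b^{S_i}_{it}(w_j);b^{S_{-i}}_{-it}(v_{-it}))\big]$. Auction feasibility. $(x,y,u)$ is $n$-buyer auction feasible via $A$ if for all $\gamma=o(1)$, whenever $n$ buyers with values i.i.d. from $\mathcal{D}$ run clever $\gamma$-mean-based strategies, then for all $i,j$: $X^A_{ij}=x_j\pm O(\gamma)$, $Y^A_{ij}=y_j\pm O(\gamma)$, $U^A_{ij}=u_j\pm O(\gamma)$. *)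

(* Defs.v *)
From HB Require Import structures.
From mathcomp Require Import all_boot all_order all_algebra perm.
From mathcomp Require Import all_classical all_reals all_analysis.
Import Order.TTheory GRing.Theory Num.Theory.
Import numFieldNormedType.Exports.

Set Implicit Arguments.
Unset Strict Implicit.
Unset Printing Implicit Defensive.

Local Open Scope classical_set_scope.
Local Open Scope ring_scope.

Record value_dist (R : realType) (m : nat) := ValueDist {
  val_of :> 'I_m -> R;
  prob_of : 'I_m -> R;
  val_ge0 : forall j, 0 <= val_of j;
  val_increasing : forall j k : 'I_m, (j < k)%N -> val_of j < val_of k;
  prob_gt0 : forall j, 0 < prob_of j;
  prob_sum1 : \sum_j prob_of j = 1 }.

(* The bid space is the support of the value distribution: [Some j] is the
   participating arm labelled by the j-th value, [None] is the non-participation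
   arm. *)
Definition arm (m : nat) := option 'I_m.

(* The order of the labels.  [None] is least; it stays strictly below [Some j]
   even in the degenerate case where the j-th value is 0. *)
Definition arm_le (m : nat) (b c : arm m) : bool :=
  match b, c with
  | None, _ => true
  | Some _, None => false
  | Some j, Some k => (j <= k)%N
  end.

Definition label (R : realType) (m : nat) (D : value_dist R m) (b : arm m) : R :=
  if b is Some j then D j else 0.

Notation profile n V := {ffun 'I_n -> V}.

Definition upd (n : nat) (V : Type) (f : profile n V) (i : 'I_n) (x : V) :
    profile n V :=
  [ffun k => if k == i then x else f k].

Record auction (R : realType) (n m : nat) (D : value_dist R m) := Auction {
  alloc : profile n (arm m) -> 'I_n -> R;
  price : profile n (arm m) -> 'I_n -> R;
  alloc_ge0 : forall (b : profile n (arm m)) (i : 'I_n), 0 <= alloc b i;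
  alloc_sum_le1 : forall b, \sum_i alloc b i <= 1;
  alloc_none : forall (b : profile n (arm m)) (i : 'I_n), b i = None -> alloc b i = 0;
  price_ge0 : forall (b : profile n (arm m)) (i : 'I_n), 0 <= price b i;
  price_le : forall (b : profile n (arm m)) (i : 'I_n), price b i <= label D (b i) * alloc b i;
  alloc_sym : forall (s : 'S_n) (b : profile n (arm m)) (i : 'I_n),
    alloc [ffun k => b (s k)] i = alloc b (s i);
  price_sym : forall (s : 'S_n) (b : profile n (arm m)) (i : 'I_n),
    price [ffun k => b (s k)] i = price b (s i);
  alloc_mono : forall (b : profile n (arm m)) (i : 'I_n) (c d : arm m), arm_le c d ->
    alloc (upd b i c) i <= alloc (upd b i d) i;
  price_mono : forall (b : profile n (arm m)) (i : 'I_n) (c d : arm m), arm_le c d ->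
    price (upd b i c) i <= price (upd b i d) i }.

Record lottery (R : realType) (m : nat) := Lottery {
  pull_prob :> arm m -> R;
  pull_prob_ge0 : forall b, 0 <= pull_prob b;
  pull_prob_sum1 : \sum_b pull_prob b = 1 }.

Lemma pure_ge0 (R : realType) m (c b : arm m) : 0 <= (b == c)%:R :> R.
Proof. exact: ler0n. Qed.

Lemma pure_sum1 (R : realType) m (c : arm m) : \sum_b (b == c)%:R = 1 :> R.
Proof.
by rewrite (bigD1 c) //= eqxx big1 ?addr0 // => b /negPf ->.
Qed.

Definition pure (R : realType) m (c : arm m) : lottery R m :=
  Lottery (pure_ge0 R c) (pure_sum1 R c).

(* What a buyer sees after a round: the value, the arm pulled, and for every
   arm the allocation probability and the price that this arm would have
   obtained against the arms pulled by the others (full feedback). *)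
Definition observation (R : realType) (m : nat) : Type :=
  ('I_m * arm m * (arm m -> R * R))%type.

Definition strategy (R : realType) (m : nat) :=
  seq (observation R m) -> 'I_m -> lottery R m.

Section Play.
Variables (R : realType) (n m : nat) (D : value_dist R m).

(* All values and all arms of the past rounds, oldest first. *)
Definition history := seq (profile n 'I_m * profile n (arm m)).

(* The rounds of a play are numbered from 0; [A t] is the auction of round t. *)
Implicit Types (A : nat -> auction n D) (S : 'I_n -> strategy R m).
Implicit Types (h : history) (i : 'I_n) (v : profile n 'I_m)
               (b : profile n (arm m)).

Definition observe (a : auction n D) i v b : observation R m :=
  (v i, b i, fun c => (alloc a (upd b i c) i, price a (upd b i c) i)).

Definition observations A i h : seq (observation R m) :=
  [seq observe (A r.1) i r.2.1 r.2.2 | r <- zip (iota 0 (size h)) h].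

Definition values_exp (G : profile n 'I_m -> R) : R :=
  \sum_(v : profile n 'I_m) (\prod_k prob_of D (v k)) * G v.

(* Buyer k plays as if the current value were [v k], after the history h. *)
Definition arms_exp A S h v (G : profile n (arm m) -> R) : R :=
  \sum_(b : profile n (arm m)) (\prod_k S k (observations A k h) (v k) (b k)) * G b.

(* Expectation of F over the random history of the first t rounds. *)
Fixpoint history_exp A S (t : nat) (F : history -> R) : R :=
  if t is t'.+1 then
    history_exp A S t' (fun h =>
      values_exp (fun v => arms_exp A S h v (fun b => F (rcons h (v, b)))))
  else F [::].

(* Expectation of the sum over rounds t < T of G t v b, where v and b are the
   values and the arms of round t. *)
Definition total_exp A S (T : nat)
    (G : nat -> profile n 'I_m -> profile n (arm m) -> R) : R :=
  \sum_(t < T) history_exp A S t (fun h =>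
    values_exp (fun v => arms_exp A S h v (fun b => G t v b))).

(* The same, except that in round t (and only there) buyer i draws an arm for
   the value j instead of the realized value. *)
Definition total_exp_at A S (T : nat) i (j : 'I_m)
    (G : nat -> profile n (arm m) -> R) : R :=
  \sum_(t < T) history_exp A S t (fun h =>
    values_exp (fun v => arms_exp A S h (upd v i j) (fun b => G t b))).

Definition X_avg A S (T : nat) i (j : 'I_m) : R :=
  T%:R^-1 * total_exp_at A S T i j (fun t b => alloc (A t) b i).

Definition Y_avg A S (T : nat) i (j : 'I_m) : R :=
  T%:R^-1 * total_exp_at A S T i j
              (fun t b => alloc (A t) (upd b i (Some j)) i).

Definition U_avg A S (T : nat) i (j : 'I_m) : R :=
  T%:R^-1 * total_exp_at A S T i j
              (fun t b => D j * alloc (A t) b i - price (A t) b i).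

Definition total_utility A S (T : nat) i : R :=
  total_exp A S T (fun t v b => D (v i) * alloc (A t) b i - price (A t) b i).

(* sigma_{i,b,s}(v), where s is the number of observations in the list. *)
Definition cumulative_utility (o : seq (observation R m)) (b : arm m)
    (v : 'I_m) : R :=
  \sum_(r <- o) (D v * (r.2 b).1 - (r.2 b).2).

(* A strategy is indexed by the horizon T, since it may depend on it. *)
Definition never_overbids i (S : nat -> strategy R m) : Prop :=
  forall (T : nat) A h (v : 'I_m) (b : arm m), (size h < T)%N ->
    D v < label D b -> S T (observations A i h) v b = 0.

Definition mean_based (gamma : nat -> R) i (S : nat -> strategy R m) : Prop :=
  forall (T : nat) A h (v : 'I_m) (b b' : arm m), (size h < T)%N ->
    label D b <= D v -> label D b' <= D v ->
    cumulative_utility (observations A i h) b v <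
      cumulative_utility (observations A i h) b' v - gamma T * T%:R ->
    S T (observations A i h) v b <= gamma T.

(* Buyer i plays s, and buyer k != i pulls arm [beta t k] in round t. *)
Definition against_fixed i (s : strategy R m)
    (beta : nat -> profile n (arm m)) : 'I_n -> strategy R m :=
  fun k => if k == i then s else fun o _ => pure R (beta (size o) k).

Definition no_regret i (S : nat -> strategy R m) : Prop :=
  forall eps : R, 0 < eps -> \forall T \near \oo,
    forall A (beta : nat -> profile n (arm m)) (f : 'I_m -> arm m),
      (forall j, label D (f j) <= D j) ->
      total_utility A (against_fixed i (fun _ j => pure R (f j)) beta) T i
        - total_utility A (against_fixed i (S T) beta) T i <= eps * T%:R.

Definition clever (gamma : nat -> R) i (S : nat -> strategy R m) : Prop :=
  [/\ never_overbids i S, mean_based gamma i S & no_regret i S].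

(* [A T] is the sequence of auctions that is run when the horizon is T. *)
Definition auction_feasible_via (A : nat -> nat -> auction n D)
    (x y u : 'rV[R]_m) : Prop :=
  forall gamma : nat -> R, (forall T, 0 < gamma T) -> gamma @ \oo --> 0 ->
  forall S : 'I_n -> nat -> strategy R m, (forall i, clever gamma i (S i)) ->
  forall (i : 'I_n) (j : 'I_m),
    [/\ (fun T => X_avg (A T) (S ^~ T) T i j - x ord0 j) =O_\oo gamma,
        (fun T => Y_avg (A T) (S ^~ T) T i j - y ord0 j) =O_\oo gamma
      & (fun T => U_avg (A T) (S ^~ T) T i j - u ord0 j) =O_\oo gamma].

End Play.

Definition feasible_set (R : realType) (n m : nat) (D : value_dist R m) :
    set ('rV[R]_m * 'rV[R]_m * 'rV[R]_m) :=
  [set p | exists A : nat -> nat -> auction n D,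
             auction_feasible_via A p.1.1 p.1.2 p.2].

(* Main.v *)
(* The distribution has values 1, 2, 6 with the middle one rare.  In any auction
   sequence, y_3 = 1 forces buyers not to pull the top arm, and a nearly maximal x_3
   forces high values not to pull the low arm: high values pull the middle arm, whose
   price is therefore at least what high values pay.

   Two such points are feasible: in the first, middle and high values pool on a free
   middle arm; in the second, low and middle values pool on the free low arm and the
   middle arm costs its full label.  At their midpoint the middle arm is so expensive
   on average that neither the low nor the middle arm, played throughout, gives a
   middle value the utility u_2 of the midpoint.  But exponential weights, a clever
   strategy, never earns more than the best fixed arm in hindsight, and the utilities
   in hindsight are concentrated around their means, because the play of the rival is
   essentially known except at the rare middle value.

   The two points are feasible because in each of them every value has an arm that is
   optimal against all rival arms, and strictly so against low ones; mean-based buyers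
   therefore settle on it after O(gamma T + 1) rounds.  That 1 = O(gamma T) follows
   from no-regret: were gamma T small, a buyer would be following the leader, which
   has linear regret when the lead alternates. *)
Require Import Defs.
From mathcomp Require Import all_boot all_order all_algebra perm.
From mathcomp Require Import all_classical all_reals all_analysis.
From mathcomp Require Import ring lra.
Import Order.TTheory GRing.Theory Num.Theory.
Import numFieldNormedType.Exports.

Set Implicit Arguments.
Unset Strict Implicit.
Unset Printing Implicit Defensive.

Local Open Scope classical_set_scope.
Local Open Scope ring_scope.

(** * Expectations as monotone normalized linear functionals *)

Section Mean.
Context {R : realType}.

(** [P] plays the part of an almost sure event: functions need to be compared only on it. This makes
    supports of lotteries and lengths of histories available under the expectation. *)
Record is_mean (X : Type) (P : X -> Prop) (E : (X -> R) -> R) : Prop := IsMean {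
  meanD : forall f g, E (fun x => f x + g x) = E f + E g;
  meanZ : forall c f, E (fun x => c * f x) = c * E f;
  mean_le : forall f g, (forall x, P x -> f x <= g x) -> E f <= E g;
  mean1 : E (fun=> 1) = 1 }.

Section MeanTheory.
Variables (X : Type) (P : X -> Prop) (E : (X -> R) -> R).
Hypothesis mE : is_mean P E.

Lemma mean_eq f g : (forall x, P x -> f x = g x) -> E f = E g.
Proof.
by move=> fg; apply/le_anti/andP; split; apply: (mean_le mE) => x /fg ->.
Qed.

Lemma mean_cst c : E (fun=> c) = c.
Proof.
rewrite (@mean_eq _ (fun=> c * 1)); first by rewrite (meanZ mE) (mean1 mE) mulr1.
by move=> x _; rewrite mulr1.
Qed.

Lemma meanB f g : E (fun x => f x - g x) = E f - E g.
Proof.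
rewrite (@mean_eq _ (fun x => f x + -1 * g x)).
  by rewrite (meanD mE) (meanZ mE) mulN1r.
by move=> x _; rewrite mulN1r.
Qed.

Lemma meanN f : E (fun x => - f x) = - E f.
Proof.
rewrite (@mean_eq _ (fun x => -1 * f x)); first by rewrite (meanZ mE) mulN1r.
by move=> x _; rewrite mulN1r.
Qed.

Lemma meanZr c f : E (fun x => f x * c) = E f * c.
Proof.
rewrite mulrC -(meanZ mE); apply: mean_eq => x _; exact: mulrC.
Qed.

Lemma mean_sum I (r : seq I) (Q : pred I) (F : I -> X -> R) :
  E (fun x => \sum_(i <- r | Q i) F i x) = \sum_(i <- r | Q i) E (F i).
Proof.
elim: r => [|i r ih].
  by rewrite big_nil (@mean_eq _ (fun=> 0)) ?mean_cst // => x _; rewrite big_nil.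
rewrite big_cons -ih; case: ifP => Qi.
  rewrite -(meanD mE); apply: mean_eq => x _; by rewrite big_cons Qi.
by apply: mean_eq => x _; rewrite big_cons Qi.
Qed.

Lemma mean_ge0 f : (forall x, P x -> 0 <= f x) -> 0 <= E f.
Proof. by move=> f0; rewrite -(mean_cst 0); exact: (mean_le mE). Qed.

Lemma mean_leC f c : (forall x, P x -> f x <= c) -> E f <= c.
Proof. by move=> fc; rewrite -(mean_cst c); exact: (mean_le mE). Qed.

Lemma mean_geC f c : (forall x, P x -> c <= f x) -> c <= E f.
Proof. by move=> fc; rewrite -(mean_cst c); exact: (mean_le mE). Qed.

Lemma mean_norm f : `|E f| <= E (fun x => `|f x|).
Proof.
rewrite ler_norml -meanN; apply/andP; split; apply: (mean_le mE) => x _.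
  by rewrite lerNl -normrN ler_norm.
exact: ler_norm.
Qed.

End MeanTheory.

Definition wexp (T : finType) (p : T -> R) (f : T -> R) : R :=
  \sum_x p x * f x.

Lemma wexp_mean (T : finType) (p : T -> R) :
  (forall x, 0 <= p x) -> \sum_x p x = 1 -> is_mean (fun x => 0 < p x) (wexp p).
Proof.
move=> p0 p1; split.
- by move=> f g; rewrite /wexp -big_split; apply: eq_bigr => x _; rewrite mulrDr.
- move=> c f; rewrite /wexp mulr_sumr; apply: eq_bigr => x _; exact: mulrCA.
- move=> f g fg; apply: ler_sum => x _.
  have := p0 x; rewrite le_eqVlt => /orP[/eqP <-|px]; first by rewrite !mul0r.
  by rewrite ler_pM2l // fg.
- by rewrite /wexp -[RHS]p1; apply: eq_bigr => x _; rewrite mulr1.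
Qed.

Lemma comp_mean (X Y : Type) (P : X -> Prop) (Q : X -> Y -> Prop)
    (E : (X -> R) -> R) (E' : X -> (Y -> R) -> R) :
  is_mean P E -> (forall x, is_mean (Q x) (E' x)) ->
  is_mean (fun z => P z.1 /\ Q z.1 z.2)
    (fun f : X * Y -> R => E (fun x => E' x (fun y => f (x, y)))).
Proof.
move=> mE mE'; split.
- move=> f g; rewrite -(meanD mE); apply: (mean_eq mE) => x _.
  exact: (meanD (mE' x)).
- move=> c f; rewrite -(meanZ mE); apply: (mean_eq mE) => x _.
  exact: (meanZ (mE' x)).
- move=> f g fg; apply: (mean_le mE) => x Px; apply: (mean_le (mE' x)) => y Qy.
  exact: fg.
- rewrite -[RHS](mean1 mE); apply: (mean_eq mE) => x _; exact: (mean1 (mE' x)).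
Qed.

End Mean.

(** * Profiles of two buyers *)

Section Duo.

Definition rival (i : 'I_2) : 'I_2 := rev_ord i.

Lemma rivalK : involutive rival.
Proof. exact: rev_ordK. Qed.

Lemma rival_neq i : (rival i == i) = false.
Proof. by case: i => [[|[]]]. Qed.

Lemma neq_rival (i k : 'I_2) : k != i -> k = rival i.
Proof.
by case: i => -[|[|]] // hi; case: k => -[|[|]] // hk ni; apply/val_inj.
Qed.

Lemma prod_rival (R : realType) (i : 'I_2) (F : 'I_2 -> R) :
  \prod_k F k = F i * F (rival i).
Proof.
rewrite (bigD1 i) //= (bigD1 (rival i)) ?rival_neq //= big1 ?mulr1 // => k.
by case/andP=> /neq_rival ->; rewrite eqxx.
Qed.

Lemma sum_rival (R : realType) (i : 'I_2) (F : 'I_2 -> R) :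
  \sum_k F k = F i + F (rival i).
Proof.
rewrite (bigD1 i) //= (bigD1 (rival i)) ?rival_neq //= big1 ?addr0 // => k.
by case/andP=> /neq_rival ->; rewrite eqxx.
Qed.

Definition duo (V : Type) (i : 'I_2) (x y : V) : profile 2 V :=
  [ffun k => if k == i then x else y].

Lemma duo1 V i (x y : V) : duo i x y i = x.
Proof. by rewrite ffunE eqxx. Qed.

Lemma duo2 V i (x y : V) : duo i x y (rival i) = y.
Proof. by rewrite ffunE rival_neq. Qed.

Lemma duoE V i (f : profile 2 V) : duo i (f i) (f (rival i)) = f.
Proof.
by apply/ffunP => k; rewrite ffunE; case: eqVneq => [->//|/neq_rival ->].
Qed.

Lemma duo_rival V i (x y : V) : duo (rival i) x y = duo i y x.
Proof. by rewrite -[RHS](duoE (rival i)) rivalK duo1 duo2. Qed.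

Lemma upd_duo V i (x y z : V) : upd (duo i x y) i z = duo i z y.
Proof. by rewrite -[LHS](duoE i) !ffunE eqxx rival_neq. Qed.

Lemma upd_rival V i (f : profile 2 V) z : upd f i z = duo i z (f (rival i)).
Proof. by rewrite -{1}(duoE i f) upd_duo. Qed.

Lemma sum_duo (R : realType) (V : finType) i (F : profile 2 V -> R) :
  \sum_f F f = \sum_x \sum_y F (duo i x y).
Proof.
rewrite pair_big /= (reindex (fun p : V * V => duo i p.1 p.2)) //.
exists (fun f : profile 2 V => (f i, f (rival i))) => [[x y] _|f _] /=.
  by rewrite duo1 duo2.
exact: duoE.
Qed.

End Duo.

(** * Expectations over rounds and histories *)

Section Play.
Context {R : realType} {m : nat} {D : value_dist R m}.
Implicit Types (A : nat -> auction 2 D) (S : 'I_2 -> strategy R m).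
Implicit Types (h : history 2 m) (i : 'I_2).

Definition val_exp := wexp (prob_of D).

Lemma val_mean : is_mean (fun=> True) val_exp.
Proof.
have [a b c d] := wexp_mean (fun j => ltW (prob_gt0 D j)) (prob_sum1 D).
by split=> // f g fg; apply: c => x _; exact: fg.
Qed.

Lemma lot_mean (l : lottery R m) : is_mean (fun b => 0 < l b) (wexp l).
Proof. exact: wexp_mean (pull_prob_ge0 l) (pull_prob_sum1 l). Qed.

Definition act A S h i j : lottery R m := S i (observations A i h) j.

(** The rival's value is kept next to its arm because the concentration argument compares the arm
    with the one expected at that value. *)
Definition rival_exp A S h i (G : 'I_m * arm m -> R) : R :=
  val_exp (fun v => wexp (act A S h (rival i) v) (fun c => G (v, c))).

Lemma rival_mean A S h i :
  is_mean (fun z => True /\ 0 < act A S h (rival i) z.1 z.2) (rival_exp A S h i).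
Proof. exact: comp_mean val_mean (fun v => lot_mean (act A S h (rival i) v)). Qed.

Lemma rival_value A S h i (G : 'I_m -> R) :
  rival_exp A S h i (fun z => G z.1) = val_exp G.
Proof.
apply: (mean_eq val_mean) => v _ /=.
by rewrite (mean_cst (lot_mean (act A S h (rival i) v))).
Qed.

Definition round_exp A S h (F : profile 2 'I_m -> profile 2 (arm m) -> R) : R :=
  values_exp D (fun v => arms_exp A S h v (F v)).

Lemma arms_duo A S h i v (G : profile 2 (arm m) -> R) :
  arms_exp A S h v G =
  wexp (act A S h i (v i)) (fun b =>
    wexp (act A S h (rival i) (v (rival i))) (fun c => G (duo i b c))).
Proof.
rewrite /arms_exp (sum_duo i) /wexp; apply: eq_bigr => b _.
rewrite mulr_sumr; apply: eq_bigr => c _.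
by rewrite (prod_rival i) duo1 duo2 mulrA.
Qed.

Lemma values_duo i (G : profile 2 'I_m -> R) :
  values_exp D G = val_exp (fun x => val_exp (fun y => G (duo i x y))).
Proof.
rewrite /values_exp (sum_duo i) /val_exp /wexp; apply: eq_bigr => b _.
rewrite mulr_sumr; apply: eq_bigr => c _.
by rewrite (prod_rival i) duo1 duo2 mulrA.
Qed.

Lemma wexp_swap (T U : finType) (p : T -> R) (q : U -> R) F :
  wexp p (fun x => wexp q (fun y => F x y)) =
  wexp q (fun y => wexp p (fun x => F x y)).
Proof.
rewrite /wexp; under eq_bigr do rewrite mulr_sumr.
rewrite exchange_big; apply: eq_bigr => y _ /=.
by rewrite mulr_sumr; apply: eq_bigr => x _; rewrite mulrCA.
Qed.

(** Given the history the buyers draw independently, so the draws of buyer [i] can come first and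
    those of the rival form one inner mean. *)
Lemma round_duo A S h i F :
  round_exp A S h F = val_exp (fun x => wexp (act A S h i x) (fun b =>
    rival_exp A S h i (fun z => F (duo i x z.1) (duo i b z.2)))).
Proof.
rewrite /round_exp (values_duo i); apply: (mean_eq val_mean) => x _.
rewrite /rival_exp /val_exp wexp_swap; apply: (mean_eq val_mean) => y _.
by rewrite (arms_duo _ _ _ i) duo1 duo2.
Qed.

Lemma round_at A S h i j (G : profile 2 (arm m) -> R) :
  values_exp D (fun v => arms_exp A S h (upd v i j) G) =
  wexp (act A S h i j) (fun b => rival_exp A S h i (fun z => G (duo i b z.2))).
Proof.
rewrite (values_duo i); under eq_fun => x.
  under eq_fun do rewrite upd_duo (arms_duo _ _ _ i) duo1 duo2.
  over.
rewrite (mean_cst val_mean) /rival_exp /val_exp wexp_swap.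
by [].
Qed.

Lemma round_rival A S h i (G : 'I_m * arm m -> R) :
  round_exp A S h (fun v b => G (v (rival i), b (rival i))) = rival_exp A S h i G.
Proof.
rewrite (round_duo _ _ _ i); under eq_fun => x.
  under eq_fun => b.
    under eq_fun => z do rewrite !duo2 -surjective_pairing.
    over.
  rewrite (mean_cst (lot_mean _)).
  over.
exact: (mean_cst val_mean).
Qed.

Lemma round_mean A S h :
  is_mean (fun=> True) (fun F => round_exp A S h (fun v b => F (v, b))).
Proof.
have m1 := comp_mean val_mean (fun x => comp_mean (lot_mean (act A S h ord0 x))
  (fun b => rival_mean A S h ord0)).
split.
- move=> f g; rewrite !(round_duo _ _ _ ord0).
  exact: (meanD m1 (fun t => f (duo ord0 t.1 t.2.2.1, duo ord0 t.2.1 t.2.2.2))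
                   (fun t => g (duo ord0 t.1 t.2.2.1, duo ord0 t.2.1 t.2.2.2))).
- move=> c f; rewrite !(round_duo _ _ _ ord0).
  exact: (meanZ m1 c (fun t => f (duo ord0 t.1 t.2.2.1, duo ord0 t.2.1 t.2.2.2))).
- move=> f g fg; rewrite !(round_duo _ _ _ ord0).
  apply: (mean_le m1
    (f := fun t => f (duo ord0 t.1 t.2.2.1, duo ord0 t.2.1 t.2.2.2))
    (g := fun t => g (duo ord0 t.1 t.2.2.1, duo ord0 t.2.1 t.2.2.2))).
  by move=> t _; exact: fg.
- rewrite (round_duo _ _ _ ord0); exact: (mean1 m1).
Qed.

Lemma hist_expS A S t F : history_exp A S t.+1 F =
  history_exp A S t (fun h => round_exp A S h (fun v b => F (rcons h (v, b)))).
Proof. by []. Qed.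

Lemma hist_mean A S t : is_mean (fun h => size h = t) (history_exp A S t).
Proof.
elim: t => [|t ih]; first by split=> //= f g; exact.
split.
- move=> f g; rewrite !hist_expS -(meanD ih); apply: (mean_eq ih) => h _.
  exact: (meanD (round_mean A S h) (fun x => f (rcons h x)) (fun x => g (rcons h x))).
- move=> c f; rewrite !hist_expS -(meanZ ih); apply: (mean_eq ih) => h _.
  exact: (meanZ (round_mean A S h) c (fun x => f (rcons h x))).
- move=> f g fg; rewrite !hist_expS; apply: (mean_le ih) => h ht.
  apply: (mean_le (round_mean A S h) (f := fun x => f (rcons h x))
    (g := fun x => g (rcons h x))) => x _.
  by apply: fg; rewrite size_rcons ht.
- rewrite hist_expS -[RHS](mean1 ih); apply: (mean_eq ih) => h _.
  exact: (mean1 (round_mean A S h)).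
Qed.

(** All potential arguments below rest on this identity; [F] will be a cumulative utility, the
    potential of exponential weights, a capped count of low arms, or a squared sum of noise. *)
Lemma hist_telescope A S T (F : history 2 m -> R) :
  \sum_(t < T) history_exp A S t (fun h =>
     round_exp A S h (fun v b => F (rcons h (v, b)) - F h)) =
  history_exp A S T F - F [::].
Proof.
elim: T => [|T ih]; first by rewrite big_ord0 subrr.
rewrite big_ord_recr ih hist_expS /=.
have -> : history_exp A S T (fun h => round_exp A S h
    (fun v b => F (rcons h (v, b)) - F h)) =
  history_exp A S T (fun h => round_exp A S h (fun v b => F (rcons h (v, b))))
  - history_exp A S T F.
  rewrite -(meanB (hist_mean A S T)); apply: (mean_eq (hist_mean A S T)) => h _.
  rewrite (meanB (round_mean A S h) (fun x => F (rcons h x)) (fun=> F h)).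
  by rewrite (mean_cst (round_mean A S h)).
by rewrite addrC addrA subrK.
Qed.

Lemma total_atE A S T i j G :
  total_exp_at A S T i j G = \sum_(t < T) history_exp A S t (fun h =>
    wexp (act A S h i j) (fun b => rival_exp A S h i (fun z => G t (duo i b z.2)))).
Proof.
apply: eq_bigr => t _; apply: (mean_eq (hist_mean A S t)) => h _.
exact: round_at.
Qed.

End Play.

(** * Two-buyer auctions and the utilities of arms in hindsight *)

Section Duel.
Context {R : realType} {m : nat} {D : value_dist R m}.
Implicit Types (a : auction 2 D) (A : nat -> auction 2 D).
Implicit Types (S : 'I_2 -> strategy R m).
Implicit Types (h : history 2 m) (i : 'I_2) (b c : arm m) (j k : 'I_m).

Definition al a i b c : R := alloc a (duo i b c) i.
Definition pay a i b c : R := price a (duo i b c) i.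
Definition rew a i j b c : R := D j * al a i b c - pay a i b c.

Lemma al_ge0 a i b c : 0 <= al a i b c.
Proof. exact: alloc_ge0. Qed.

Lemma al_sum a i b c : al a i b c + al a (rival i) c b <= 1.
Proof.
by have := alloc_sum_le1 a (duo i b c); rewrite (sum_rival i) /al duo_rival.
Qed.

Lemma al_le1 a i b c : al a i b c <= 1.
Proof. by have := al_sum a i b c; have := al_ge0 a (rival i) c b; lra. Qed.

Lemma al_none a i c : al a i None c = 0.
Proof. by rewrite /al alloc_none ?duo1. Qed.

Lemma pay_ge0 a i b c : 0 <= pay a i b c.
Proof. exact: price_ge0. Qed.

Lemma pay_le a i b c : pay a i b c <= label D b * al a i b c.
Proof. by have := price_le a (duo i b c) i; rewrite duo1. Qed.

Lemma pay_mono a i b b' c : arm_le b b' -> pay a i b c <= pay a i b' c.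
Proof. by move/(price_mono a (duo i b c) i); rewrite !upd_duo. Qed.

Lemma al_rival a i b c : al a (rival i) b c = al a i b c.
Proof.
have := alloc_sym a (tperm i (rival i)) (duo i b c) (rival i).
rewrite tpermR /al => <-; congr (alloc a _ _); apply/ffunP => k; rewrite !ffunE.
case: (eqVneq k i) => [->|/neq_rival ->].
  by rewrite tpermL rival_neq eq_sym rival_neq.
by rewrite tpermR !eqxx.
Qed.

(** By symmetry both buyers get the same share at a tie. *)
Lemma al_tie a i b : al a i b b <= 2^-1.
Proof. have := al_sum a i b b; rewrite al_rival; lra. Qed.

Lemma rew_ge0 a i j b c : label D b <= D j -> 0 <= rew a i j b c.
Proof.
move=> bj; rewrite subr_ge0 (le_trans (pay_le _ _ _ _)) //.
by rewrite ler_wpM2r // al_ge0.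
Qed.

Lemma rew_le a i j b c : rew a i j b c <= D j.
Proof.
rewrite /rew lerBlDr (le_trans (y := D j)) //; last by rewrite lerDl pay_ge0.
by rewrite -[leRHS]mulr1 ler_wpM2l ?val_ge0 // al_le1.
Qed.

Lemma rew_none a i j c : rew a i j None c = 0.
Proof.
have := pay_le a i None c; have := pay_ge0 a i None c.
by rewrite /rew al_none !mulr0 => ? ?; lra.
Qed.

Lemma val_le j k : (D j <= D k) = (j <= k)%N.
Proof.
apply/idP/idP; first by apply: contraTT; rewrite -ltnNge -ltNge => /(val_increasing D).
by rewrite leq_eqVlt => /orP[/eqP/val_inj ->//|/(val_increasing D)/ltW].
Qed.

Definition cum A i h b j : R := cumulative_utility D (observations A i h) b j.

Lemma observations_rcons A i h v (b : profile 2 (arm m)) :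
  observations A i (rcons h (v, b)) =
  rcons (observations A i h) (observe (A (size h)) i v b).
Proof.
rewrite /observations size_rcons -[(size h).+1]addn1 iotaD add0n /= cats1 zip_rcons ?size_iota //.
by rewrite map_rcons.
Qed.

Lemma size_observations A i h : size (observations A i h) = size h.
Proof. by rewrite size_map size_zip size_iota minnn. Qed.

Lemma cum_nil A i b j : cum A i [::] b j = 0.
Proof. by rewrite /cum /cumulative_utility big_nil. Qed.

Lemma cum_rcons A i h b j v (b' : profile 2 (arm m)) :
  cum A i (rcons h (v, b')) b j =
  cum A i h b j + rew (A (size h)) i j b (b' (rival i)).
Proof.
rewrite /cum /cumulative_utility observations_rcons -cats1 big_cat big_seq1 /=.
by rewrite upd_rival.
Qed.

(** With full feedback the increment of [cum] does not involve the buyer's own arm, so only the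
    rival's draw is averaged. *)
Lemma hist_cum A S i b j T :
  history_exp A S T (fun h => cum A i h b j) =
  \sum_(t < T) history_exp A S t (fun h =>
    rival_exp A S h i (fun z => rew (A t) i j b z.2)).
Proof.
have := hist_telescope A S T (fun h => cum A i h b j); rewrite cum_nil subr0 => <-.
apply: eq_bigr => t _; apply: (mean_eq (hist_mean A S t)) => h ht.
rewrite -round_rival; congr round_exp; apply/funext => v; apply/funext => b' /=.
by rewrite cum_rcons ht addrC addKr.
Qed.

Lemma wexp_mean_swap (T : finType) (p : T -> R) (X : Type) (P : X -> Prop) E
    (F : T -> X -> R) :
  is_mean P E -> wexp p (fun x => E (F x)) = E (fun y => wexp p (fun x => F x y)).
Proof.
move=> mE; rewrite /wexp (mean_sum mE); apply: eq_bigr => x _.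
by rewrite (meanZ mE).
Qed.

Definition utility_at A S T i j : R :=
  total_exp_at A S T i j (fun t p => D j * alloc (A t) p i - price (A t) p i).

Lemma utility_atE A S T i j :
  utility_at A S T i j = \sum_(t < T) history_exp A S t (fun h =>
    rival_exp A S h i (fun z => wexp (act A S h i j) (fun b => rew (A t) i j b z.2))).
Proof.
rewrite /utility_at total_atE; apply: eq_bigr => t _.
apply: (mean_eq (hist_mean A S t)) => h _.
by rewrite (wexp_mean_swap _ _ (rival_mean A S h i)).
Qed.

(** The current value is independent of the history and of the rival's draw, so it may be fixed
    throughout and averaged last. *)
Lemma total_utilityE A S T i :
  total_utility A S T i = val_exp (D := D) (utility_at A S T i).
Proof.
rewrite /total_utility /total_exp /utility_at.
under [in RHS]eq_fun do rewrite total_atE.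
rewrite (mean_sum (val_mean (D := D))); apply: eq_bigr => t _.
rewrite [RHS](wexp_mean_swap _ _ (hist_mean A S t)).
apply: (mean_eq (hist_mean A S t)) => h _.
rewrite -/(round_exp A S h (fun v p => D (v i) * alloc (A t) p i - price (A t) p i)).
rewrite (round_duo _ _ _ i); apply: (mean_eq (val_mean (D := D))) => j _.
apply: (mean_eq (lot_mean _)) => b _; apply: (mean_eq (rival_mean _ _ _ _)) => z _.
by rewrite duo1.
Qed.

(** * Exponential weights *)

Section Hedge.
Variable eta : R.

(* Exponential weights; non-participation gets weight 0, since its utility 0 never
   exceeds that of the lowest arm. *)
Definition hedge_weight (o : seq (observation R m)) j b : R :=
  if b is Some k then
    if (k <= j)%N then expR (eta * cumulative_utility D o b j) else 0
  else 0.

Definition hedge_total o j := \sum_b hedge_weight o j b.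

Lemma hedge_weight_ge0 o j b : 0 <= hedge_weight o j b.
Proof. by case: b => [k|] //=; case: ifP => // _; exact: expR_ge0. Qed.

Lemma hedge_total_ge o j b : hedge_weight o j b <= hedge_total o j.
Proof.
rewrite /hedge_total (bigD1 b) //= lerDl sumr_ge0 // => c _.
exact: hedge_weight_ge0.
Qed.

Lemma hedge_total_gt0 o j : 0 < hedge_total o j.
Proof.
by apply: lt_le_trans (hedge_total_ge o j (Some j)); rewrite /= leqnn expR_gt0.
Qed.

Lemma hedge_ge0 o j b : 0 <= hedge_weight o j b / hedge_total o j.
Proof. by rewrite divr_ge0 ?hedge_weight_ge0 // ltW // hedge_total_gt0. Qed.

Lemma hedge_sum1 o j : \sum_b hedge_weight o j b / hedge_total o j = 1.
Proof. by rewrite -mulr_suml divff // gt_eqF // hedge_total_gt0. Qed.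

Definition hedge : strategy R m := fun o j =>
  Lottery (hedge_ge0 o j) (hedge_sum1 o j).

Lemma hedge_support o j b : 0 < hedge o j b -> exists2 k, b = Some k & (k <= j)%N.
Proof.
case: b => [k|] /=; last by rewrite mul0r ltxx.
by case: ifP => [kj _|]; [exists k|rewrite mul0r ltxx].
Qed.

Lemma hedge_support_label o j b : 0 < hedge o j b -> label D b <= D j.
Proof. by case/hedge_support => k -> kj; rewrite /= val_le. Qed.

Lemma hedge_total_rcons A i h j v (b : profile 2 (arm m)) :
  hedge_total (observations A i (rcons h (v, b))) j =
  hedge_total (observations A i h) j *
  wexp (hedge (observations A i h) j)
    (fun c => expR (eta * rew (A (size h)) i j c (b (rival i)))).
Proof.
rewrite {1}/hedge_total /wexp mulr_sumr; apply: eq_bigr => c _.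
rewrite mulrA /= mulrCA divff ?mulr1 ?gt_eqF ?hedge_total_gt0 //.
case: c => [k|]; rewrite /= ?mul0r //; case: ifP => _; rewrite ?mul0r //.
by rewrite -expRD -mulrDr -!/(cum _ _ _ _ _) cum_rcons.
Qed.

(** The log-partition function of the weights. Its increments are log moment generating functions of
    the reward of the drawn arm. *)
Definition hedge_pot A i j h := ln (hedge_total (observations A i h) j).

Lemma hedge_pot_rcons A i h j v (b : profile 2 (arm m)) :
  hedge_pot A i j (rcons h (v, b)) - hedge_pot A i j h =
  ln (wexp (hedge (observations A i h) j)
    (fun c => expR (eta * rew (A (size h)) i j c (b (rival i))))).
Proof.
rewrite /hedge_pot hedge_total_rcons lnM ?posrE ?hedge_total_gt0 //.
  by rewrite addrC addKr.
have := hedge_total_gt0 (observations A i (rcons h (v, b))) j.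
by rewrite hedge_total_rcons pmulr_rgt0 // hedge_total_gt0.
Qed.

(** Jensen's inequality for the exponential, obtained from its tangent at the mean [M]. *)
Lemma hedge_step_ge o j (r : arm m -> R) :
  eta * wexp (hedge o j) r <= ln (wexp (hedge o j) (fun c => expR (eta * r c))).
Proof.
set M := wexp _ r; have ml := lot_mean (hedge o j).
have le_exp : expR (eta * M) <= wexp (hedge o j) (fun c => expR (eta * r c)).
  have -> : expR (eta * M) =
      wexp (hedge o j) (fun c => expR (eta * M) * (1 + eta * (r c - M))).
    rewrite (meanZ ml) (meanD ml) (mean_cst ml) (meanZ ml) (meanB ml) (mean_cst ml).
    by rewrite subrr mulr0 addr0 mulr1.
  apply: (mean_le ml) => c _.
  have -> : eta * r c = eta * M + eta * (r c - M) by ring.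
  by rewrite expRD ler_wpM2l ?expR_ge0 // expR_ge1Dx.
rewrite -[leLHS]expRK ler_ln ?posrE ?expR_gt0 //.
exact: lt_le_trans (expR_gt0 _) le_exp.
Qed.

(** From 1 - x <= [expR (- x)] one gets [expR x] <= 1 / (1 - x), and (1 + x + 2 x^2) (1 - x) = 1 +
    x^2 (1 - 2 x) >= 1. *)
Lemma expR_le_quadratic (x : R) : 0 <= x -> x <= 2^-1 ->
  expR x <= 1 + x + 2 * x ^+ 2.
Proof.
move=> x0 x1; have := expR_ge1Dx (- x); rewrite expRN => h.
have h1 : 1 <= (1 + x + 2 * x ^+ 2) * (1 - x) by nra.
rewrite -[leLHS]mul1r -ler_pdivlMr ?expR_gt0 //.
apply: le_trans h1 _; rewrite ler_wpM2l //; nra.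
Qed.

Lemma hedge_step_le o j (r : arm m -> R) V : 0 <= eta -> eta * V <= 2^-1 ->
  (forall c, 0 < hedge o j c -> 0 <= r c <= V) ->
  ln (wexp (hedge o j) (fun c => expR (eta * r c))) <=
  eta * wexp (hedge o j) r + 2 * eta ^+ 2 * V ^+ 2.
Proof.
move=> eta0 etaV rV; have ml := lot_mean (hedge o j).
have M0 : 0 <= wexp (hedge o j) r by apply: (mean_ge0 ml) => c /rV /andP[].
have le_exp : wexp (hedge o j) (fun c => expR (eta * r c)) <=
    1 + (eta * wexp (hedge o j) r + 2 * eta ^+ 2 * V ^+ 2).
  have -> : 1 + (eta * wexp (hedge o j) r + 2 * eta ^+ 2 * V ^+ 2) =
      wexp (hedge o j) (fun c => 1 + (eta * r c + 2 * eta ^+ 2 * V ^+ 2)).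
    by rewrite !(meanD ml) (meanZ ml) !(mean_cst ml).
  apply: (mean_le ml) => c /rV /andP[r0 rV'].
  have x0 : 0 <= eta * r c by rewrite mulr_ge0.
  have xV : eta * r c <= eta * V by rewrite ler_wpM2l.
  apply: le_trans (expR_le_quadratic x0 (le_trans xV etaV)) _.
  rewrite addrA lerD2l exprMn -mulrA ler_wpM2l // ler_wpM2l ?exprn_ge0 //.
  by rewrite ler_sqr ?nnegrE // (le_trans r0).
have exp_ge1 : 1 <= wexp (hedge o j) (fun c => expR (eta * r c)).
  apply: (mean_geC ml) => c /rV /andP[r0 _].
  by rewrite -expR0 ler_expR mulr_ge0.
have q0 : 0 <= 2 * eta ^+ 2 * V ^+ 2 by rewrite mulr_ge0 ?sqr_ge0 // mulr_ge0 ?sqr_ge0.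
have p0 : 0 <= eta * wexp (hedge o j) r by rewrite mulr_ge0.
set q := eta * _ + _ in le_exp *; have q1 : 0 <= q by rewrite addr_ge0.
apply: (@le_trans _ _ (ln (1 + q))); last by rewrite le_ln1Dx // (lt_le_trans _ q1).
by rewrite ler_ln ?posrE // ?(lt_le_trans _ exp_ge1) // ltr_wpDr.
Qed.

Lemma hedge_pot_nil A i j : hedge_pot A i j [::] <= m.+1%:R.
Proof.
have : hedge_total (observations A i [::]) j <= m.+1%:R.
  rewrite (le_trans (y := \sum_(b : arm m) 1)) //.
    apply: ler_sum => -[k|] _ //=; case: ifP => // _.
    by rewrite -/(cum _ _ _ _ _) cum_nil mulr0 expR0.
  by rewrite sumr_const card_option card_ord.
have := hedge_total_gt0 (observations A i [::]) j.
rewrite -{1 2}[hedge_total _ _](addrNK 1) addrC => h1 h2.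
apply: le_trans (_ : hedge_total (observations A i [::]) j - 1 <= _); last by lra.
rewrite /hedge_pot -{1}[hedge_total _ _](addrNK 1) addrC le_ln1Dx //; lra.
Qed.

Lemma hedge_pot_ge A i j h k : (k <= j)%N ->
  eta * cum A i h (Some k) j <= hedge_pot A i j h.
Proof.
move=> kj; rewrite /hedge_pot -[leLHS]expRK ler_ln ?posrE ?expR_gt0 ?hedge_total_gt0 //.
by have := hedge_total_ge (observations A i h) j (Some k); rewrite /= kj.
Qed.

Section Run.
Variables (A : nat -> auction 2 D) (S : 'I_2 -> strategy R m) (i : 'I_2) (j : 'I_m).
Hypothesis Si : S i = hedge.

Lemma hedge_telescope T :
  history_exp A S T (hedge_pot A i j) - hedge_pot A i j [::] =
  \sum_(t < T) history_exp A S t (fun h => rival_exp A S h i (fun z =>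
     ln (wexp (act A S h i j) (fun c => expR (eta * rew (A t) i j c z.2))))).
Proof.
rewrite -hist_telescope; apply: eq_bigr => t _.
apply: (mean_eq (hist_mean A S t)) => h ht.
rewrite -round_rival; congr round_exp; apply/funext => v; apply/funext => b' /=.
by rewrite hedge_pot_rcons ht /act Si.
Qed.

(** The less usual direction: exponential weights never outperform their potential. The
    infeasibility of the midpoint depends on it. *)
Lemma hedge_utility_le T : eta * utility_at A S T i j <=
  history_exp A S T (hedge_pot A i j) - hedge_pot A i j [::].
Proof.
rewrite hedge_telescope utility_atE mulr_sumr; apply: ler_sum => t _.
rewrite -(meanZ (hist_mean A S t)); apply: (mean_le (hist_mean A S t)) => h _.
rewrite -(meanZ (rival_mean _ _ _ _)); apply: (mean_le (rival_mean _ _ _ _)) => z _.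
by rewrite /act Si hedge_step_ge.
Qed.

(** The direction behind the regret bound, with a second-order error in each round. *)
Lemma hedge_utility_ge T V : 0 <= eta -> eta * V <= 2^-1 -> D j <= V ->
  history_exp A S T (hedge_pot A i j) - hedge_pot A i j [::] <=
  eta * utility_at A S T i j + (2 * eta ^+ 2 * V ^+ 2) * T%:R.
Proof.
move=> eta0 etaV DV; rewrite hedge_telescope utility_atE mulr_sumr.
rewrite -[T in X in _ <= _ + X]card_ord mulr_natr -sumr_const -big_split.
apply: ler_sum => t _ /=; have mh := hist_mean A S t.
rewrite -(meanZ mh) -[X in _ + X](mean_cst mh) -(meanD mh).
apply: (mean_le mh) => h _; have mr := rival_mean A S h i.
rewrite -(meanZ mr) -[X in _ + X](mean_cst mr) -(meanD mr).
apply: (mean_le mr) => z _; rewrite /act Si hedge_step_le // => c c0.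
by rewrite rew_ge0 ?(hedge_support_label c0) // (le_trans (rew_le _ _ _ _ _)).
Qed.

End Run.
End Hedge.
End Duel.

(** * Exponential weights are a clever strategy *)

Section Clever.
Context {R : realType} {m : nat} {D : value_dist R m}.
Implicit Types (A : nat -> auction 2 D) (S : 'I_2 -> strategy R m).
Implicit Types (h : history 2 m) (i : 'I_2) (j k : 'I_m).

Lemma wexp_pure (c : arm m) (g : arm m -> R) : wexp (pure R c) g = g c.
Proof.
rewrite /wexp (bigD1 c) //= eqxx mul1r big1 ?addr0 // => b /negPf ->.
by rewrite mul0r.
Qed.

Section Fixed.
Variables (A : nat -> auction 2 D) (S : 'I_2 -> strategy R m) (i : 'I_2).
Variable beta : nat -> profile 2 (arm m).
Hypothesis S_rival : S (rival i) = fun o _ => pure R (beta (size o) (rival i)).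

Lemma rival_fixed h (g : arm m -> R) :
  rival_exp A S h i (fun z => g z.2) = g (beta (size h) (rival i)).
Proof.
rewrite /rival_exp /act S_rival size_observations /=.
by under eq_fun do rewrite wexp_pure; rewrite (mean_cst val_mean).
Qed.

Lemma hist_cum_fixed T b j : history_exp A S T (fun h => cum A i h b j) =
  \sum_(t < T) rew (A t) i j b (beta t (rival i)).
Proof.
rewrite hist_cum; apply: eq_bigr => t _.
rewrite -[RHS](mean_cst (hist_mean A S t)); apply: (mean_eq (hist_mean A S t)) => h ht.
by rewrite (rival_fixed h (rew (A t) i j b)) ht.
Qed.

Lemma utility_at_fixed T j : utility_at A S T i j =
  \sum_(t < T) history_exp A S t (fun h =>
    wexp (act A S h i j) (fun b => rew (A t) i j b (beta t (rival i)))).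
Proof.
rewrite utility_atE; apply: eq_bigr => t _; apply: (mean_eq (hist_mean A S t)) => h ht.
rewrite (rival_fixed h (fun c => wexp (act A S h i j) (fun b => rew (A t) i j b c))).
by rewrite ht.
Qed.

End Fixed.

Lemma against_rival i (s : strategy R m) beta :
  against_fixed i s beta (rival i) = fun o _ => pure R (beta (size o) (rival i)).
Proof. by rewrite /against_fixed rival_neq. Qed.

Lemma against_self i (s : strategy R m) beta : against_fixed i s beta i = s.
Proof. by rewrite /against_fixed eqxx. Qed.

Lemma utility_at_pure A i (f : 'I_m -> arm m) beta T j :
  utility_at A (against_fixed i (fun _ j => pure R (f j)) beta) T i j =
  \sum_(t < T) rew (A t) i j (f j) (beta t (rival i)).
Proof.
set S := against_fixed _ _ _.
rewrite (utility_at_fixed _ (against_rival _ _ _)); apply: eq_bigr => t _.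
rewrite -[RHS](mean_cst (hist_mean A S t)); apply: (mean_eq (hist_mean A S t)) => h ht.
by rewrite /act against_self wexp_pure.
Qed.

Lemma hedge_overbid eta o j b : D j < label D b -> hedge (D := D) eta o j b = 0.
Proof.
case: b => [k|] /= jb; last by rewrite mul0r.
by rewrite -(val_le (D := D)) leNgt jb /= mul0r.
Qed.

Lemma cum_ge0 A i h b j : label D b <= D j -> 0 <= cum A i h b j.
Proof.
move=> bj; elim/last_ind: h => [|h [v b'] ih]; first by rewrite cum_nil.
by rewrite cum_rcons addr_ge0 // rew_ge0.
Qed.

Lemma cum_none A i h j : cum A i h None j = 0.
Proof.
elim/last_ind: h => [|h [v b'] ih]; first by rewrite cum_nil.
by rewrite cum_rcons ih rew_none addr0.
Qed.

(** The weight of [b'] exceeds that of [b] by a factor of at least [expR (eta * g)] >= 1 + eta g.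
    Non-participation has weight 0 as [b], and as [b'] it cannot be ahead, since arms up to the
    value never lose. *)
Lemma hedge_le_gap A i h eta g j b b' : 0 <= eta -> 0 <= g ->
  label D b' <= D j -> label D b <= D j ->
  cum A i h b j < cum A i h b' j - g ->
  hedge (D := D) eta (observations A i h) j b <= (1 + eta * g)^-1.
Proof.
move=> eta0 g0 b'j bj gap.
have den0 : 0 < 1 + eta * g by rewrite ltr_wpDr // mulr_ge0.
case: b bj gap => [k|] bj gap; last by rewrite /= mul0r invr_ge0 ltW.
case: b' b'j gap => [k'|] b'j gap; last first.
  by move: gap; rewrite cum_none ltNge (le_trans _ (cum_ge0 _ _ _ bj)) // subr_le0.
move: bj b'j; rewrite /= !val_le => kj k'j; rewrite kj.
set W := hedge_total _ _ _; have W0 : 0 < W by exact: hedge_total_gt0.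
have := hedge_total_ge (D := D) eta (observations A i h) j (Some k').
rewrite /= k'j -!/(cum _ _ _ _ _) -/W => kW.
rewrite ler_pdivrMr // [leRHS]mulrC ler_pdivlMr //.
apply: le_trans kW; have := expR_ge1Dx (eta * g); rewrite addrC => e1.
apply: le_trans (_ : expR (eta * cum A i h (Some k) j) * expR (eta * g) <= _).
  by rewrite ler_wpM2l ?expR_ge0 // addrC.
by rewrite -expRD ler_expR -mulrDr ler_wpM2l //; move: gap; lra.
Qed.

(** (T + 1)^(-1/4). Its square will be the learning rate, which makes the regret of order sqrt T;
    the successor keeps the rate positive at T = 0. *)
Definition rate (T : nat) : R := (Num.sqrt (Num.sqrt T.+1%:R))^-1.

Lemma rate_gt0 T : 0 < rate T.
Proof. by rewrite invr_gt0 !sqrtr_gt0. Qed.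

Lemma rate4 T : rate T ^+ 4 = T.+1%:R^-1.
Proof.
rewrite /rate exprVn -[4%N]/(2 * 2)%N exprM !sqr_sqrtr ?sqrtr_ge0 //.
Qed.

Lemma rate_le1 T : rate T <= 1.
Proof.
have := rate_gt0 T; have := rate4 T => e r0.
rewrite -(@ler_pXn2r _ 4) ?nnegrE ?ler01 ?(ltW r0) //.
by rewrite e expr1n invf_le1 // ler1n.
Qed.

Lemma rate_near (e : R) : 0 < e -> \forall T \near \oo, rate T <= e.
Proof.
move=> e0; near=> T.
rewrite -(@ler_pXn2r _ 4) ?nnegrE ?(ltW e0) ?(ltW (rate_gt0 _)) //.
rewrite rate4 invf_ple ?posrE ?exprn_gt0 // (le_trans (y := T%:R)) ?ler_nat //.
near: T; exact: nbhs_infty_ger.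
Unshelve. all: by end_near.
Qed.

Lemma rate_cvg0 : rate @ \oo --> (0 : R).
Proof.
apply/cvgrPdist_le => e /rate_near; apply: filterS => T h.
by rewrite sub0r normrN ger0_norm // ltW // rate_gt0.
Qed.

(** The final potential lies above [eta] times the utility of any fixed arm in hindsight, and not
    far above [eta] times the utility earned. *)
Lemma hedge_regret A i (beta : nat -> profile 2 (arm m)) f T j eta V :
  0 < eta -> eta * V <= 2^-1 -> D j <= V -> label D (f j) <= D j ->
  eta * (utility_at A (against_fixed i (fun _ j => pure R (f j)) beta) T i j
    - utility_at A (against_fixed i (hedge (D := D) eta) beta) T i j) <=
  m.+1%:R + 2 * eta ^+ 2 * V ^+ 2 * T%:R.
Proof.
move=> eta0 etaV DV fj; rewrite utility_at_pure; set S := against_fixed _ _ _.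
have Si : S i = hedge (D := D) eta by exact: against_self.
have mh := hist_mean A S T.
rewrite -(hist_cum_fixed _ (against_rival i (hedge (D := D) eta) beta)) -/S mulrBr.
have potE : eta * history_exp A S T (fun h => cum A i h (f j) j) <=
    history_exp A S T (hedge_pot (D := D) eta A i j).
  rewrite -(meanZ mh); apply: (mean_le mh) => h _; case: (f j) fj => [k|] /= fj.
    by rewrite hedge_pot_ge // -(val_le (D := D)).
  rewrite cum_none mulr0 (le_trans _ (hedge_pot_ge _ _ _ _ (leqnn j))) //.
  by rewrite mulr_ge0 ?cum_ge0 // ltW.
have := hedge_utility_ge A Si T (ltW eta0) etaV DV.
have := hedge_pot_nil (D := D) eta A i j.
by move: potE; lra.
Qed.

Lemma hedge_no_regret i : no_regret D i (fun T => hedge (D := D) (rate T ^+ 2)).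
Proof.
(* [V] bounds all values at once. As eta^2 T <= 1, [K] bounds eta times the regret, so it remains to
   have K <= eta T eps for large T. *)
move=> eps eps0; pose V := \sum_j D j; pose K := m.+1%:R + 2 * V ^+ 2.
have V0 : 0 <= V by apply: sumr_ge0 => j _; exact: val_ge0.
have K0 : 0 < K by rewrite ltr_pwDl // mulr_ge0 ?sqr_ge0.
have KE : 0 < 1 + K / eps by rewrite ltr_pwDl // divr_ge0 // ltW.
near=> T => A beta f fD.
have g0 := rate_gt0 T; have g1 := rate_le1 T; have g4 := rate4 T.
rewrite !total_utilityE -(meanB val_mean).
apply: (mean_leC val_mean) => j _.
set eta := rate T ^+ 2; have eta0 : 0 < eta by rewrite exprn_gt0.
have etag : eta <= rate T by rewrite /eta expr2 ger_pMr.
have etaV : eta * V <= 2^-1.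
  have : rate T <= (2 * (V + 1))^-1.
    by near: T; apply: rate_near; rewrite invr_gt0 mulr_gt0 // ltr_wpDl.
  rewrite invfM => h; have : eta <= 2^-1 / (V + 1) by exact: le_trans h.
  rewrite ler_pdivlMr ?ltr_wpDl //; nra.
have DV : D j <= V.
  by rewrite /V (bigD1 j) //= lerDl sumr_ge0 // => k _; exact: val_ge0.
have := hedge_regret A i beta T eta0 etaV DV (fD j).
move=> hR; rewrite [leRHS]mulrC.
rewrite -(ler_pM2l eta0) (le_trans hR) //.
have etaT : eta ^+ 2 * (1 + T%:R) = 1.
  by rewrite /eta -exprM g4 nat1r mulVf.
have etaK : eta * (1 + K / eps) <= 1.
  rewrite -ler_pdivlMr // div1r (le_trans etag) //.
  by near: T; apply: rate_near; rewrite invr_gt0.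
have etaK' : eta * (eps + K) <= eps.
  have -> : eps + K = (1 + K / eps) * eps by rewrite mulrDl mul1r divfK ?gt_eqF.
  by rewrite mulrA ger_pMl.
have T0 : 0 <= T%:R :> R by [].
have e1 : eta ^+ 2 * T%:R <= 1 by have := sqr_ge0 eta; lra.
have : eta ^+ 2 * T%:R * V ^+ 2 <= V ^+ 2 by rewrite ler_piMl ?sqr_ge0.
have : K <= eta * (T%:R * eps).
  rewrite -(ler_pM2l eta0); nra.
rewrite /K; nra.
Unshelve. all: by end_near.
Qed.

(** For gamma = [rate T], learning rate gamma^2 and gap gamma T, [hedge_le_gap] gives 1 / (1 +
    gamma^3 T). This is at most gamma because gamma + gamma^4 T >= gamma^4 (T + 1) = 1. *)
Lemma hedge_mean_based i : mean_based D rate i (fun T => hedge (D := D) (rate T ^+ 2)).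
Proof.
move=> T A h j b b' hT bj b'j gap.
have g0 := rate_gt0 T; have g1 := rate_le1 T; have g4 := rate4 T.
have gT : 0 <= rate T * T%:R by rewrite mulr_ge0 // ltW.
apply: le_trans (hedge_le_gap (sqr_ge0 (rate T)) gT b'j bj gap) _.
have pT : rate T ^+ 4 * T.+1%:R = 1 by rewrite g4 mulVf.
rewrite invf_ple ?posrE //; last first.
  by rewrite ltr_pwDl // !mulr_ge0 ?sqr_ge0 // ltW.
rewrite -(ler_pM2l g0) divff ?gt_eqF // -[leLHS]pT.
have -> : T.+1%:R = 1 + T%:R :> R by rewrite nat1r.
have : rate T ^+ 4 <= rate T by rewrite exprS ger_pMr // exprn_ile1 // ltW.
have -> : rate T * (1 + rate T ^+ 2 * (rate T * T%:R)) = rate T + rate T ^+ 4 * T%:R.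
  by ring.
by rewrite mulrDr mulr1; lra.
Qed.

Lemma hedge_clever i : clever D rate i (fun T => hedge (D := D) (rate T ^+ 2)).
Proof.
split; [|exact: hedge_mean_based|exact: hedge_no_regret].
by move=> T A h j b _; exact: hedge_overbid.
Qed.

End Clever.

(** * Auctions given by an allocation table and a price per unit of allocation *)

Section Duel.
Context {R : realType} {m : nat} {D : value_dist R m}.
Implicit Types (b c : arm m) (i : 'I_2) (p : profile 2 (arm m)).

Lemma rival_perm (s : 'S_2) i : s (rival i) = rival (s i).
Proof. by apply: neq_rival; rewrite (inj_eq perm_inj) rival_neq. Qed.

Variables (g : arm m -> arm m -> R) (rho : arm m -> R).
Hypotheses (g_ge0 : forall b c, 0 <= g b c)
  (g_sum : forall b c, g b c + g c b <= 1)
  (g_none : forall c, g None c = 0)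
  (g_mono : forall b b' c, arm_le b b' -> g b c <= g b' c)
  (rho_ge0 : forall b, 0 <= rho b)
  (rho_le : forall b, rho b <= label D b)
  (rho_mono : forall b b', arm_le b b' -> rho b <= rho b').

Definition duel_alloc (p : profile 2 (arm m)) i := g (p i) (p (rival i)).
Definition duel_price (p : profile 2 (arm m)) i := rho (p i) * duel_alloc p i.

Lemma duel_sum_le1 p : \sum_i duel_alloc p i <= 1.
Proof. by rewrite (sum_rival ord0) /duel_alloc rivalK g_sum. Qed.

Lemma duel_none p i : p i = None -> duel_alloc p i = 0.
Proof. by rewrite /duel_alloc => ->. Qed.

Lemma duel_price_ge0 p i : 0 <= duel_price p i.
Proof. by rewrite /duel_price /duel_alloc mulr_ge0. Qed.

Lemma duel_price_le p i : duel_price p i <= label D (p i) * duel_alloc p i.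
Proof. by rewrite ler_wpM2r // /duel_alloc. Qed.

Lemma duel_sym (s : 'S_2) (p : profile 2 (arm m)) i :
  duel_alloc [ffun k => p (s k)] i = duel_alloc p (s i).
Proof. by rewrite /duel_alloc !ffunE rival_perm. Qed.

Lemma duel_price_sym (s : 'S_2) (p : profile 2 (arm m)) i :
  duel_price [ffun k => p (s k)] i = duel_price p (s i).
Proof. by rewrite /duel_price duel_sym ffunE. Qed.

Lemma duel_mono (p : profile 2 (arm m)) i c d : arm_le c d ->
  duel_alloc (upd p i c) i <= duel_alloc (upd p i d) i.
Proof. by move=> cd; rewrite /duel_alloc !ffunE eqxx rival_neq g_mono. Qed.

Lemma duel_price_mono (p : profile 2 (arm m)) i c d : arm_le c d ->
  duel_price (upd p i c) i <= duel_price (upd p i d) i.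
Proof.
move=> cd; rewrite /duel_price ler_pM ?duel_mono ?/duel_alloc //.
by rewrite !ffunE eqxx rho_mono.
Qed.

Definition duel : auction 2 D :=
  Auction (fun p i => g_ge0 (p i) (p (rival i))) duel_sum_le1 duel_none
    duel_price_ge0 duel_price_le duel_sym duel_price_sym duel_mono duel_price_mono.

Lemma al_duel i b c : al duel i b c = g b c.
Proof. by rewrite /al /= /duel_alloc duo1 duo2. Qed.

Lemma pay_duel i b c : pay duel i b c = rho b * g b c.
Proof. by rewrite /pay /= /duel_price /duel_alloc duo1 duo2. Qed.

Lemma rew_duel i j b c : rew duel i j b c = (D j - rho b) * g b c.
Proof. by rewrite /rew al_duel pay_duel mulrBl. Qed.

End Duel.

(** * Tables on three arms and the value distribution *)

Section Triple.
Context {R : realType}.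

Definition vec3 (x y z : R) (b : arm 3) : R :=
  if b is Some k then nth 0 [:: x; y; z] k else 0.

Lemma vec3_ge0 x y z b : 0 <= x -> 0 <= y -> 0 <= z -> 0 <= vec3 x y z b.
Proof. by case: b => [[[|[|[|//]]] hk]|] /=. Qed.

Lemma vec3_mono x y z b c : 0 <= x -> x <= y -> y <= z -> arm_le b c ->
  vec3 x y z b <= vec3 x y z c.
Proof.
by case: b => [[[|[|[|//]]] hk]|]; case: c => [[[|[|[|//]]] hk']|] //=; lra.
Qed.

Lemma vec3_le x y z (f : arm 3 -> R) b : 0 <= f None ->
  x <= f (Some (@Ordinal 3 0 isT)) ->
  y <= f (Some (@Ordinal 3 1 isT)) ->
  z <= f (Some (@Ordinal 3 2 isT)) -> vec3 x y z b <= f b.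
Proof.
case: b => [[[|[|[|//]]] hk]|] //= _.
- by rewrite (bool_irrelevance hk isT).
- by rewrite (bool_irrelevance hk isT).
- by rewrite (bool_irrelevance hk isT).
Qed.

End Triple.

Notation lo := (@Ordinal 3 0 isT).
Notation mid := (@Ordinal 3 1 isT).
Notation hi := (@Ordinal 3 2 isT).

Section Instance.
Context {R : realType}.

Lemma ord3P (P : 'I_3 -> Prop) : P lo -> P mid -> P hi -> forall k, P k.
Proof.
by move=> p0 p1 p2 [[|[|[|//]]] hk]; rewrite (bool_irrelevance hk isT).
Qed.

Lemma sum3 (F : 'I_3 -> R) : \sum_k F k = F lo + F mid + F hi.
Proof.
rewrite !big_ord_recr big_ord0 /= add0r.
by congr (F _ + F _ + F _); apply/val_inj.
Qed.

Definition dist_val (k : 'I_3) : R := nth 0 [:: 1; 2; 6] k.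
Definition dist_prob (k : 'I_3) : R := nth 0 [:: 1/2; 1/100; 49/100] k.

Lemma dist_val_ge0 k : 0 <= dist_val k.
Proof. by elim/ord3P: k; rewrite /dist_val /=; lra. Qed.

Lemma dist_val_increasing (j k : 'I_3) : (j < k)%N -> dist_val j < dist_val k.
Proof. by elim/ord3P: j; elim/ord3P: k => //= _; rewrite /dist_val /=; lra. Qed.

Lemma dist_prob_gt0 k : 0 < dist_prob k.
Proof. by elim/ord3P: k; rewrite /dist_prob /=; lra. Qed.

Lemma dist_prob_sum1 : \sum_k dist_prob k = 1.
Proof. by rewrite sum3 /dist_prob /=; lra. Qed.

Definition dist : value_dist R 3 :=
  ValueDist dist_val_ge0 dist_val_increasing dist_prob_gt0 dist_prob_sum1.

Lemma val_exp3 F :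
  val_exp (D := dist) F = 1/2 * F lo + 1/100 * F mid + 49/100 * F hi.
Proof. by rewrite /val_exp /wexp sum3. Qed.

End Instance.

(** * No-regret bounds gamma T away from 0 *)

Section Alternating.
Context {R : realType}.
Notation D := (@dist R).

(* For the value [mid], round 0 puts arm [mid] half a step ahead of arm [lo]; each
   later round moves the difference by one step in favour of the arm that is
   behind.  For the values [lo] and [hi], a fixed arm is optimal in every round. *)
Definition zig_alloc (t : nat) : arm 3 -> R :=
  if t is 0 then vec3 0 (1/8) (1/2) else
  if odd t then vec3 (1/4) (1/4) (1/2) else vec3 0 (1/4) (1/2).

Definition zig_price (t : nat) : arm 3 -> R :=
  if odd t then vec3 0 2 2 else vec3 0 0 0.

Lemma zig_alloc_ge0 t b : 0 <= zig_alloc t b.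
Proof. by rewrite /zig_alloc; case: t => [|t]; last case: ifP => _; apply: vec3_ge0; lra. Qed.

Lemma zig_alloc_le t b : zig_alloc t b <= 1/2.
Proof.
by rewrite /zig_alloc; case: t => [|t]; last case: ifP => _;
  apply: (vec3_le (f := fun=> 1/2)); lra.
Qed.

Lemma zig_alloc_sum t b c : zig_alloc t b + zig_alloc t c <= 1.
Proof. by have := zig_alloc_le t b; have := zig_alloc_le t c; lra. Qed.

Lemma zig_alloc_none t : zig_alloc t None = 0.
Proof. by rewrite /zig_alloc; case: t => [|t] //; case: ifP. Qed.

Lemma zig_alloc_mono t b c : arm_le b c -> zig_alloc t b <= zig_alloc t c.
Proof. by rewrite /zig_alloc; case: t => [|t]; last case: ifP => _; apply: vec3_mono; lra. Qed.

Lemma zig_price_ge0 t b : 0 <= zig_price t b.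
Proof. by rewrite /zig_price; case: ifP => _; apply: vec3_ge0; lra. Qed.

Lemma zig_price_le t b : zig_price t b <= label D b.
Proof. by rewrite /zig_price; case: ifP => _; apply: vec3_le; rewrite //= /dist_val /=; lra. Qed.

Lemma zig_price_mono t b c : arm_le b c -> zig_price t b <= zig_price t c.
Proof. by rewrite /zig_price; case: ifP => _; apply: vec3_mono; lra. Qed.

Definition zig t : auction 2 D :=
  duel (fun b _ => zig_alloc_ge0 t b) (zig_alloc_sum t) (fun=> zig_alloc_none t)
    (fun b c _ => @zig_alloc_mono t b c) (zig_price_ge0 t) (zig_price_le t)
    (@zig_price_mono t).

Lemma rew_zig t i j b c : rew (zig t) i j b c = (D j - zig_price t b) * zig_alloc t b.
Proof. exact: rew_duel. Qed.

(** After round 0 the lead alternates between the two arms, and the arm in the lead is always the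
    one that earns nothing in the coming round. *)
Lemma cum_zig i h : cum zig i h (Some mid) mid - cum zig i h (Some lo) mid =
  if size h is 0 then 0 else if odd (size h) then 1/4 else - (1/4).
Proof.
elim/last_ind: h => [|h [v p] ih]; first by rewrite !cum_nil subrr.
rewrite !cum_rcons !rew_zig size_rcons opprD addrACA ih.
rewrite /zig_price /zig_alloc; case: (size h) => [|t] /=.
  by rewrite /dist_val /=; lra.
by case: (odd t) => /=; rewrite /dist_val /=; lra.
Qed.

Lemma wexp_delta (l : lottery R 3) b : wexp l (fun c => (c == b)%:R) = l b.
Proof.
rewrite /wexp (bigD1 b) //= eqxx mulr1 big1 ?addr0 // => c /negPf ->.
by rewrite mulr0.
Qed.

Lemma sum_head_le n (F : nat -> R) a b : 0 <= a -> 0 <= b -> F 0 <= a ->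
  (forall t, (0 < t)%N -> (t < n)%N -> F t <= b) -> \sum_(t < n) F t <= a + b * n%:R.
Proof.
case: n => [|n] a0 b0 F0 Fb; first by rewrite big_ord0 mulr0 addr0.
rewrite big_ord_recl lerD // (le_trans (y := \sum_(t < n) b)) //.
  by apply: ler_sum => t _; apply: Fb.
by rewrite sumr_const card_ord -[leLHS]mulr_natr ler_wpM2l // ler_nat.
Qed.

Lemma zig_best_lo t i b c : label D b <= D lo ->
  rew (zig t) i lo b c <= rew (zig t) i lo (Some lo) c.
Proof.
case: b => [k|] hb; last by rewrite rew_none rew_ge0.
by move: hb; elim/ord3P: k => //=; rewrite /dist_val /=; lra.
Qed.

Lemma zig_best_hi t i b c :
  rew (zig t) i hi b c <= rew (zig t) i hi (Some hi) c.
Proof.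
case: b => [k|]; last by rewrite rew_none rew_ge0.
rewrite !rew_zig /zig_price /zig_alloc; case: t => [|t] /=.
  by elim/ord3P: k; rewrite /= /dist_val /=; lra.
by case: (odd t); elim/ord3P: k; rewrite /= /dist_val /=; lra.
Qed.

Section Leader.
Variables (gamma : nat -> R) (i : 'I_2) (S : nat -> strategy R 3).
Hypothesis clever_S : clever D gamma i S.

Lemma clever_support T (A : nat -> auction 2 D) h j b : (size h < T)%N ->
  0 < S T (observations A i h) j b -> label D b <= D j.
Proof.
case: clever_S => over _ _ hT; rewrite leNgt; apply: contraTN => /(over T A h j b hT) ->.
by rewrite ltxx.
Qed.

(** The trailing arm [b0] is the only one that earns something, namely 1/2. Its deficit 1/4 exceeds
    the mean-based threshold, so it is pulled with probability at most [gamma T]. *)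
Lemma zig_leader T (h : history 2 3) : (size h < T)%N -> (0 < size h)%N ->
  0 <= gamma T -> gamma T * T%:R < 1/4 ->
  wexp (S T (observations zig i h) mid) (fun b => rew (zig (size h)) i mid b None)
  <= gamma T / 2.
Proof.
move=> hT h0 gT0 gT; set l := S T _ _; have ml := lot_mean l.
have [_ mb _] := clever_S; have gap := cum_zig i h.
pose b0 := Some (if odd (size h) then lo else mid) : arm 3.
pose b1 := Some (if odd (size h) then mid else lo) : arm 3.
have l0 : l b0 <= gamma T.
  apply: (mb T zig h mid b0 b1 hT); rewrite /b0 /b1.
  - by case: ifP => _ //=; rewrite /dist_val /=; lra.
  - by case: ifP => _ //=; rewrite /dist_val /=; lra.
  - rewrite -!/(cum _ _ _ _ _); move: gap h0; case: (size h) => [|t] //=.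
    by case: (odd t) => /=; lra.
apply: (@le_trans _ _ (wexp l (fun b => 1/2 * (b == b0)%:R))); last first.
  by rewrite (meanZ ml) wexp_delta; lra.
apply: (mean_le ml) => b /(clever_support hT); rewrite /b0.
move: h0; case: (size h) => [|t] // _.
case: b => [k|_]; last by rewrite rew_none mulr_ge0.
rewrite rew_zig /zig_price /zig_alloc; elim/ord3P: k => /=.
- by move=> _; case: (odd t) => /=; rewrite /dist_val /=; lra.
- by move=> _; case: (odd t) => /=; rewrite /dist_val /=; lra.
- by rewrite /dist_val /=; lra.
Qed.

(** Otherwise a middle value would earn only a bounded amount in the alternating auctions, whereas
    pulling [lo] throughout earns about T / 4. *)
Lemma clever_rate_ge : (forall T, 0 < gamma T) -> \forall T \near \oo, 1/4 <= gamma T * T%:R.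
Proof.
move=> gamma0; have [_ _ nr] := clever_S.
(* The loss T / 4 occurs at a value of probability 1/100, so the regret is about T / 400. Half of
   this already contradicts no-regret as soon as T >= 20 absorbs the constants. *)
have e0 : 0 < 1/800 :> R by lra.
near=> T; rewrite leNgt; apply/negP => gT.
have T20 : (20 <= T)%N by near: T; exact: nbhs_infty_ge.
have nrT : forall (A : nat -> auction 2 D) (beta : nat -> profile 2 (arm 3)) f,
    (forall j, label D (f j) <= D j) ->
    total_utility A (against_fixed i (fun _ j => pure R (f j)) beta) T i
      - total_utility A (against_fixed i (S T) beta) T i <= 1/800 * T%:R.
  by near: T; exact: nr _ e0.
pose beta (_ : nat) : profile 2 (arm 3) := [ffun=> None].
(* For the values [lo] and [hi] this arm is best in every round, so they cannot offset the regret of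
   [mid]. *)
pose f (k : 'I_3) : arm 3 := Some (if k == hi then hi else lo).
have fD j : label D (f j) <= D j.
  by rewrite /f; elim/ord3P: j => /=; rewrite /dist_val /=; lra.
have := nrT zig beta f fD; rewrite !total_utilityE -(meanB val_mean) val_exp3.
rewrite !utility_at_pure.
set S' := against_fixed _ _ _.
have S'i : S' i = S T by exact: against_self.
have uE k : utility_at zig S' T i k = \sum_(t < T) history_exp zig S' t (fun h =>
    wexp (act zig S' h i k) (fun b => rew (zig t) i k b None)).
  rewrite (utility_at_fixed _ (against_rival _ _ _)); apply: eq_bigr => t _.
  by rewrite ffunE.
have u_lo : utility_at zig S' T i lo <=
    \sum_(t < T) rew (zig t) i lo (f lo) (beta t (rival i)).
  rewrite uE; apply: ler_sum => t _; apply: (mean_leC (hist_mean _ _ _)) => h ht.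
  apply: (mean_leC (lot_mean _)) => b; rewrite /act S'i ffunE => bS.
  by apply: zig_best_lo; apply: clever_support bS; rewrite ht.
have u_hi : utility_at zig S' T i hi <=
    \sum_(t < T) rew (zig t) i hi (f hi) (beta t (rival i)).
  rewrite uE; apply: ler_sum => t _; apply: (mean_leC (hist_mean _ _ _)) => h ht.
  apply: (mean_leC (lot_mean _)) => b _; rewrite ffunE; exact: zig_best_hi.
have u_mid : utility_at zig S' T i mid <= 2 + gamma T / 2 * T%:R.
  rewrite uE (sum_head_le (F := fun t => history_exp zig S' t (fun h =>
    wexp (act zig S' h i mid) (fun b => rew (zig t) i mid b None)))) //.
  - by rewrite divr_ge0 // ltW.
  - apply: (mean_leC (hist_mean _ _ _)) => h _; apply: (mean_leC (lot_mean _)) => b _.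
    exact: rew_le.
  - move=> t t0 tT; apply: (mean_leC (hist_mean _ _ _)) => h ht.
    by rewrite /act S'i -ht; apply: zig_leader; rewrite ?ht // ltW.
have c_mid : (T%:R - 1) / 4 <= \sum_(t < T) rew (zig t) i mid (f mid) (beta t (rival i)).
  have step (t : nat) : rew (zig t) i mid (f mid) (beta t (rival i)) =
      if odd t then 1/2 else 0.
    rewrite rew_zig /zig_price /zig_alloc; case: t => [|t] /=.
      by rewrite mulr0.
    by case: (odd t); rewrite /= /dist_val /=; lra.
  suff : (T%:R - (odd T)%:R) / 4 = \sum_(t < T) rew (zig t) i mid (f mid) (beta t (rival i)).
    by move=> <-; case: (odd T) => /=; lra.
  elim: (T) => [|n ih]; first by rewrite big_ord0 /= subrr mul0r.
  rewrite big_ord_recr -ih step /= -[n.+1%:R]natr1; case: (odd n) => /=; lra.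
have T20r : 20 <= T%:R :> R by rewrite ler_nat.
have gTT : gamma T / 2 * T%:R < 1/8 by move: gT; lra.
by lra.
Unshelve. all: by end_near.
Qed.

End Leader.
End Alternating.

(** * Feasibility from dominant arms *)

Section Dominance.
Context {R : realType}.
Notation D := (@dist R).
Implicit Types (h : history 2 3) (i k : 'I_2) (j : 'I_3) (b c : arm 3).

(** The arms open to the lowest value. Since a rival has that value with probability 1/2, low arms
    keep occurring whatever the rival has learned. *)
Definition low (c : arm 3) : bool := (c == None) || (c == Some lo).

Variables (a : auction 2 D) (g p : arm 3 -> arm 3 -> R) (s : 'I_3 -> arm 3).
Hypotheses (alE : forall i b c, al a i b c = g b c)
  (payE : forall i b c, pay a i b c = p b c).
Hypothesis s_label : forall j, label D (s j) <= D j.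
Hypothesis s_dom : forall j b c, label D b <= D j -> b != s j ->
  D j * g b c - p b c + 1/2 * (low c)%:R <= D j * g (s j) c - p (s j) c.

Let A : nat -> auction 2 D := fun=> a.

Definition low_count k h : R := \sum_(r <- h) (low (r.2 (rival k)))%:R.

Lemma low_count_rcons k h v (q : profile 2 (arm 3)) :
  low_count k (rcons h (v, q)) = low_count k h + (low (q (rival k)))%:R.
Proof. by rewrite /low_count -cats1 big_cat big_seq1. Qed.

Lemma cum_gap k h j b : label D b <= D j -> b != s j ->
  cum A k h b j + 1/2 * low_count k h <= cum A k h (s j) j.
Proof.
move=> bj bs; elim/last_ind: h => [|h [v q] ih].
  by rewrite !cum_nil /low_count big_nil mulr0 addr0.
rewrite !cum_rcons low_count_rcons /rew !alE !payE.
by have := s_dom (q (rival k)) bj bs; lra.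
Qed.

Section Run.
Variables (gamma : nat -> R) (S : 'I_2 -> nat -> strategy R 3).
Hypotheses (gamma_gt0 : forall T, 0 < gamma T)
  (S_clever : forall i, clever D gamma i (S i)).
Variable T : nat.

Let ST := fun i => S i T.
Let E t := history_exp A ST t.

Definition miss h k v : R := 1 - act A ST h k v (s v).

(** Each low arm of the rival adds at least 1/2 to the lead of [s v]. After more than 2 gamma T of
    them, every other arm is either an overbid or behind by more than gamma T, hence pulled with
    probability at most gamma. The factor 4 counts all arms, including [None]. *)
Lemma miss_le h k v : (size h < T)%N ->
  miss h k v <= 4 * gamma T + (low_count k h <= 2 * (gamma T * T%:R))%R%:R.
Proof.
move=> hT; have g0 := gamma_gt0 T; case: (leP (low_count k h)) => gap /=.
  have := pull_prob_ge0 (act A ST h k v) (s v).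
  by rewrite /miss => ?; have : 1%:R = 1 :> R by []; lra.
rewrite mulr0n addr0 /miss.
rewrite -[X in X - _](pull_prob_sum1 (act A ST h k v)) (bigD1 (s v)) //= addrAC subrr add0r.
have -> : 4 * gamma T = \sum_(b : arm 3) gamma T.
  by rewrite sumr_const card_option card_ord -[RHS]mulr_natl.
rewrite [leRHS](bigD1 (s v)) //= (le_trans (y := \sum_(b | b != s v) gamma T)) //.
  apply: ler_sum => b bs; have [over mb _] := S_clever k.
  have [bv|/(over T A h v b hT) E0] := leP (label D b) (D v); last by rewrite /act E0 ltW.
  apply: (mb T A h v b (s v) hT bv (s_label v)).
  by rewrite -!/(cum _ _ _ _ _); have := cum_gap k h bv bs; lra.
by rewrite lerDr ltW.
Qed.

Lemma rival_low h k : (size h < T)%N ->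
  1/2 <= rival_exp A ST h k (fun z => (low z.2)%:R).
Proof.
move=> hT; rewrite /rival_exp val_exp3.
have ge0 v : 0 <= wexp (act A ST h (rival k) v) (fun c => (low c)%:R).
  by apply: (mean_ge0 (lot_mean _)) => c _; rewrite ler0n.
have : 1 <= wexp (act A ST h (rival k) lo) (fun c => (low c)%:R).
  apply: (mean_geC (lot_mean _)) => c /(clever_support (S_clever (rival k)) hT).
  case: c => [c|_]; last by rewrite /low eqxx.
  rewrite -[label _ _]/(D c) val_le leqn0 /low => /eqP c0.
  by rewrite (_ : c = lo) ?eqxx ?orbT //; apply/val_inj.
by have := ge0 mid; have := ge0 hi; lra.
Qed.

Lemma low_count_rare k (K : R) : 0 <= K ->
  \sum_(t < T) E t (fun h => (low_count k h <= K)%R%:R) <= 2 * (K + 1).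
Proof.
(* The count capped at K + 1 grows at rate at least 1/2 as long as it is at most K. *)
move=> K0; pose F h := Num.min (low_count k h) (K + 1).
have := hist_telescope A ST T F.
have -> : F [::] = 0.
  by rewrite /F /low_count big_nil; apply/min_idPl; lra.
rewrite subr0 => tel.
have EF : E T F <= K + 1.
  by apply: (mean_leC (hist_mean A ST T)) => h _; rewrite ge_min lexx orbT.
have : 1/2 * \sum_(t < T) E t (fun h => (low_count k h <= K)%R%:R) <= E T F.
  have -> : E T F = _ := esym tel; rewrite mulr_sumr; apply: ler_sum => t _; have mh := hist_mean A ST t.
  rewrite -(meanZ mh); apply: (mean_le mh) => h ht.
  have -> : round_exp A ST h (fun v q => F (rcons h (v, q)) - F h) =
      rival_exp A ST h k (fun z => Num.min (low_count k h + (low z.2)%:R) (K + 1) - F h).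
    rewrite -round_rival; congr round_exp; apply/funext => v; apply/funext => q.
    by rewrite /F low_count_rcons.
  have mr := rival_mean A ST h k; have hT : (size h < T)%N by rewrite ht.
  have := rival_low k hT; case: (leP (low_count k h)) => NK rl.
    apply: (@le_trans _ _ (rival_exp A ST h k (fun z => (low z.2)%:R))); first by rewrite mulr1.
    apply: (mean_le mr) => z _; rewrite /F !min_l; [lra|lra|].
    by case: (low _); rewrite /=; lra.
  rewrite mulr0; apply: (mean_ge0 mr) => z _; rewrite subr_ge0 /F.
  by rewrite le_min !ge_min lexx orbT andbT lerDl ler0n.
by lra.
Qed.

(** The two parts of [miss_le] sum to at most 8 gamma T + 2, and the lower bound on gamma T absorbs
    the constant 2. *)
Lemma miss_sum k v : 1/4 <= gamma T * T%:R ->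
  \sum_(t < T) E t (fun h => miss h k v) <= 16 * (gamma T * T%:R).
Proof.
move=> gT; have g0 := gamma_gt0 T.
apply: (@le_trans _ _ (\sum_(t < T) (4 * gamma T +
    E t (fun h => (low_count k h <= 2 * (gamma T * T%:R))%R%:R)))).
  apply: ler_sum => t _; have mh := hist_mean A ST t.
  rewrite -[X in _ <= X + _](mean_cst mh) -(meanD mh); apply: (mean_le mh) => h ht.
  by apply: miss_le; rewrite ht.
rewrite big_split /= sumr_const card_ord -mulr_natr.
have := @low_count_rare k (2 * (gamma T * T%:R)).
by lra.
Qed.

Lemma wexp_miss (l : lottery R 3) b (F : arm 3 -> R) B :
  (forall c, 0 < l c -> 0 <= F c <= B) -> 0 <= F b <= B ->
  `|wexp l F - F b| <= B * (1 - l b).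
Proof.
move=> FB Fb; have ml := lot_mean l.
rewrite -[X in _ - X](mean_cst ml) -(meanB ml) (le_trans (mean_norm ml _)) //.
have -> : 1 - l b = wexp l (fun c => 1 - (c == b)%:R).
  by rewrite (meanB ml) (mean_cst ml) wexp_delta.
rewrite -(meanZ ml); apply: (mean_le ml) => c lc; have := FB c lc.
case: eqVneq => [->|_] /=; first by rewrite subrr normr0 subrr mulr0.
by move=> ?; rewrite ler_norml; lra.
Qed.

Lemma average_near i j (F : arm 3 -> arm 3 -> R) B : 0 <= B ->
  (forall b c, label D b <= D j -> 0 <= F b c <= B) ->
  1/4 <= gamma T * T%:R ->
  `|T%:R^-1 * total_exp_at A ST T i j (fun _ q => F (q i) (q (rival i))) -
    val_exp (D := D) (fun v => F (s j) (s v))| <= 32 * B * gamma T.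
Proof.
move=> B0 FB gT; have g0 := gamma_gt0 T.
have T0 : 0 < T%:R :> R by case: (T) gT => [|n] //; rewrite mulr0; lra.
set x := val_exp _.
(* First the buyer's own arm is replaced by [s j], then the rival's arm by [s v]; each replacement
   costs at most [B] times the probability of a miss. *)
have bound t h : (size h < T)%N ->
  `|wexp (act A ST h i j) (fun b => rival_exp A ST h i (fun z => F b z.2)) - x| <=
  B * (miss h i j + val_exp (D := D) (fun v => miss h (rival i) v)).
  move=> hT; have mr := rival_mean A ST h i.
  set H := fun b => rival_exp A ST h i (fun z => F b z.2).
  have HB b : label D b <= D j -> 0 <= H b <= B.
    move=> bj; apply/andP; split.
      by apply: (mean_ge0 mr) => z _; case/andP: (FB b z.2 bj).
    by apply: (mean_leC mr) => z _; case/andP: (FB b z.2 bj).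
  have -> : wexp (act A ST h i j) H - x = (wexp (act A ST h i j) H - H (s j)) + (H (s j) - x).
    by rewrite addrA subrK.
  rewrite (le_trans (ler_normD _ _)) // mulrDr lerD //.
    apply: wexp_miss; last exact: HB.
    by move=> c /(clever_support (S_clever i) hT); exact: HB.
  rewrite /H /x /rival_exp -(meanB val_mean) (le_trans (mean_norm val_mean _)) //.
  rewrite -(meanZ val_mean); apply: (mean_le val_mean) => v _.
  apply: wexp_miss; last exact: FB.
  by move=> c _; exact: FB.
have -> : total_exp_at A ST T i j (fun _ q => F (q i) (q (rival i))) =
    \sum_(t < T) E t (fun h =>
      wexp (act A ST h i j) (fun b => rival_exp A ST h i (fun z => F b z.2))).
  rewrite total_atE; apply: eq_bigr => t _; congr history_exp; apply/funext => h.
  congr wexp; apply/funext => b; congr rival_exp; apply/funext => z.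
  by rewrite duo1 duo2.
have -> : x = T%:R^-1 * \sum_(t < T) x.
  by rewrite sumr_const card_ord -[x *+ T]mulr_natl mulKf // gt_eqF.
rewrite -mulrBr normrM [`|_^-1|]ger0_norm ?invr_ge0 // ler_pdivrMl //.
rewrite -sumrB (le_trans (ler_norm_sum _ _ _)) //.
apply: (@le_trans _ _ (\sum_(t < T) B * (E t (fun h => miss h i j) +
    val_exp (D := D) (fun v => E t (fun h => miss h (rival i) v))))).
  apply: ler_sum => t _; have mh := hist_mean A ST t.
  rewrite [X in _ <= B * (_ + X)](wexp_mean_swap _ _ mh) -(meanD mh) -(meanZ mh).
  rewrite -[X in _ - X](mean_cst mh) -(meanB mh) (le_trans (mean_norm mh _)) //; apply: (mean_le mh) => h ht.
  by apply: bound; rewrite ?ht.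
rewrite -mulr_sumr big_split /= -(mean_sum val_mean).
have v16 : val_exp (D := D) (fun v => \sum_(t < T) E t (fun h => miss h (rival i) v))
    <= 16 * (gamma T * T%:R).
  by apply: (mean_leC val_mean) => v _; exact: miss_sum.
have := miss_sum i j gT.
have -> : T%:R * (32 * B * gamma T) = B * (32 * (gamma T * T%:R)) by ring.
by move=> m16; rewrite ler_wpM2l //; lra.
Qed.

End Run.
Lemma dominance_feasible : auction_feasible_via (fun _ => A)
  (\row_j val_exp (D := D) (fun v => g (s j) (s v)))
  (\row_j val_exp (D := D) (fun v => g (Some j) (s v)))
  (\row_j val_exp (D := D) (fun v => D j * g (s j) (s v) - p (s j) (s v))).
Proof.
move=> gamma gamma_gt0 _ S S_clever i j.
have rate_ge := clever_rate_ge (S_clever i) gamma_gt0.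
have val6 : D j <= 6 by elim/ord3P: j; rewrite /= /dist_val /=; lra.
have g01 b c : 0 <= g b c <= 1 by rewrite -(alE i) al_ge0 al_le1.
(* The highest value 6 serves as the common bound [B] for allocations and utilities. *)
have O192 (f : nat -> R) (F : arm 3 -> arm 3 -> R) x :
    (forall b c, label D b <= D j -> 0 <= F b c <= 6) ->
    x = val_exp (D := D) (fun v => F (s j) (s v)) ->
    (forall T, f T = T%:R^-1 * total_exp_at A (S ^~ T) T i j
       (fun _ q => F (q i) (q (rival i)))) ->
    (fun T => f T - x) =O_\oo gamma.
  move=> F6 -> fE; apply/eqO_exP; exists (32 * 6); first by lra.
  apply: filterS rate_ge => T gT; rewrite fE (gtr0_norm (gamma_gt0 T)).
  exact: average_near.
split; rewrite mxE.
- apply: (O192 _ (fun b c => g b c)) => // [b c _|T].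
    by have /andP[g0 g1] := g01 b c; rewrite g0 /=; lra.
  rewrite /X_avg; congr (_ * total_exp_at _ _ _ _ _ _); apply/funext => t; apply/funext => q.
  by rewrite -(alE i) /al duoE.
- apply: (O192 _ (fun b c => g (Some j) c)) => // [b c _|T].
    by have /andP[g0 g1] := g01 (Some j) c; rewrite g0 /=; lra.
  rewrite /Y_avg; congr (_ * total_exp_at _ _ _ _ _ _); apply/funext => t; apply/funext => q.
  by rewrite -(alE i) /al upd_rival.
- apply: (O192 _ (fun b c => D j * g b c - p b c)) => // [b c bj|T].
    rewrite -(alE i) -(payE i) -/(rew a i j b c) rew_ge0 //=.
    exact: le_trans (rew_le _ _ _ _ _) val6.
  rewrite /U_avg; congr (_ * total_exp_at _ _ _ _ _ _); apply/funext => t; apply/funext => q.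
  by rewrite -(alE i) -(payE i) /al /pay duoE.
Qed.

End Dominance.

(** * Two feasible points from auctions won by the higher arm *)

Section Points.
Context {R : realType}.
Notation D := (@dist R).

(* An absent rival counts as the lowest arm, so that higher arms are strictly
   better against it too. *)
Definition rank (b c : arm 3) : R :=
  if b is Some k then
    let l := if c is Some l then l : nat else 0%N in
    if (l < k)%N then 1 else if l == k then 1/2 else 0
  else 0.

Lemma rank_ge0 b c : 0 <= rank b c.
Proof. by rewrite /rank; case: b => [k|] //=; do ![case: ifP => _]; lra. Qed.

Lemma rank_sum b c : rank b c + rank c b <= 1.
Proof.
rewrite /rank; case: b => [k|]; case: c => [l|] /=.
- by case: ltngtP => _; lra.
- by do ![case: ifP => _]; lra.
- by do ![case: ifP => _]; lra.
- by lra.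
Qed.

Lemma rank_none c : rank None c = 0.
Proof. by []. Qed.

Lemma rank_mono b b' c : arm_le b b' -> rank b c <= rank b' c.
Proof.
case: b => [k|_]; last exact: rank_ge0.
case: b' => [k'|//]; rewrite /rank /=; set l : nat := if c is Some _ then _ else _.
move=> kk; case: ltngtP => [lk|kl|lk].
- by rewrite (leq_trans lk kk).
- by do ![case: ifP => _]; lra.
- by rewrite lk; case: ltngtP kk => // _ _; lra.
Qed.

(** The top arm costs its full label, so a high value gains nothing from it and prefers [mid]. *)
Definition ask (r : R) : arm 3 -> R := vec3 0 r 6.

Variable r : R.
Hypotheses (r_ge0 : 0 <= r) (r_le2 : r <= 2).

Lemma ask_ge0 b : 0 <= ask r b.
Proof. by apply: vec3_ge0. Qed.

Lemma ask_le b : ask r b <= label D b.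
Proof. by move: r_le2 => ?; apply: vec3_le; rewrite //= /dist_val /=; lra. Qed.

Lemma ask_mono b b' : arm_le b b' -> ask r b <= ask r b'.
Proof. by move: r_le2 => ?; apply: vec3_mono => //; lra. Qed.

Definition ranking : auction 2 D :=
  duel rank_ge0 rank_sum rank_none rank_mono ask_ge0 ask_le ask_mono.

Definition outcome (s : 'I_3 -> arm 3) : 'rV[R]_3 * 'rV[R]_3 * 'rV[R]_3 :=
  (\row_j val_exp (D := D) (fun v => rank (s j) (s v)),
   \row_j val_exp (D := D) (fun v => rank (Some j) (s v)),
   \row_j val_exp (D := D) (fun v => D j * rank (s j) (s v) - ask r (s j) * rank (s j) (s v))).

Lemma ranking_feasible s : (forall j, label D (s j) <= D j) ->
  (forall j b c, label D b <= D j -> b != s j ->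
    (D j - ask r b) * rank b c + 1/2 * (low c)%:R <= (D j - ask r (s j)) * rank (s j) c) ->
  feasible_set 2 D (outcome s).
Proof.
move=> s_label s_dom; exists (fun _ _ => ranking).
apply: (dominance_feasible (a := ranking) (g := rank) (p := fun b c => ask r b * rank b c)).
- by move=> i b c; exact: al_duel.
- by move=> i b c; exact: pay_duel.
- exact: s_label.
- by move=> j b c bj bs; rewrite -!mulrBl; exact: s_dom.
Qed.

End Points.

Section TwoPoints.
Context {R : realType}.
Notation D := (@dist R).

Definition play_mid (j : 'I_3) : arm 3 := Some (if j == lo then lo else mid).
Definition play_lo (j : 'I_3) : arm 3 := Some (if j == hi then mid else lo).

Lemma pooled_mid_feasible : feasible_set 2 D (outcome 0 play_mid).
Proof.
apply: ranking_feasible; [by []|by lra| |].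
- by move=> j; elim/ord3P: j; rewrite /= /dist_val /=; lra.
- move=> j b c; case: b => [b|] /=; case: c => [c|].
  + elim/ord3P: j; elim/ord3P: b; elim/ord3P: c => //=; rewrite /dist_val /rank /ask /low /=; lra.
  + elim/ord3P: j; elim/ord3P: b => //=; rewrite /dist_val /rank /ask /low /=; lra.
  + elim/ord3P: j; elim/ord3P: c => //=; rewrite /dist_val /rank /ask /low /=; lra.
  + elim/ord3P: j => //=; rewrite /dist_val /rank /ask /low /=; lra.
Qed.

Lemma pooled_lo_feasible : feasible_set 2 D (outcome 2 play_lo).
Proof.
apply: ranking_feasible; [by []|by lra| |].
- by move=> j; elim/ord3P: j; rewrite /= /dist_val /=; lra.
- move=> j b c; case: b => [b|] /=; case: c => [c|].
  + elim/ord3P: j; elim/ord3P: b; elim/ord3P: c => //=; rewrite /dist_val /rank /ask /low /=; lra.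
  + elim/ord3P: j; elim/ord3P: b => //=; rewrite /dist_val /rank /ask /low /=; lra.
  + elim/ord3P: j; elim/ord3P: c => //=; rewrite /dist_val /rank /ask /low /=; lra.
  + elim/ord3P: j => //=; rewrite /dist_val /rank /ask /low /=; lra.
Qed.

End TwoPoints.

(** * Averages over rounds and concentration of sums *)

Section TimeAverage.
Context {R : realType} {m : nat} {D : value_dist R m}.
Variables (A : nat -> auction 2 D) (S : 'I_2 -> strategy R m) (T : nat).

(** The expectation at a uniformly random round; being a mean, it lets averages be compared round by
    round. *)
Definition time_avg (F : nat * history 2 m -> R) : R :=
  T%:R^-1 * \sum_(t < T) history_exp A S t (fun h => F (t : nat, h)).

Lemma time_avg_mean : (0 < T)%N ->
  is_mean (fun th => (th.1 < T)%N /\ size th.2 = th.1) time_avg.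
Proof.
move=> T0; have T0R : T%:R != 0 :> R by rewrite pnatr_eq0 -lt0n.
split.
- move=> f g; rewrite /time_avg -mulrDr -big_split; congr (_ * _).
  by apply: eq_bigr => t _ /=; rewrite -(meanD (hist_mean _ _ _)).
- move=> c f; rewrite /time_avg [RHS]mulrCA; congr (_ * _); rewrite mulr_sumr.
  by apply: eq_bigr => t _ /=; rewrite -(meanZ (hist_mean _ _ _)).
- move=> f g fg; rewrite /time_avg ler_wpM2l ?invr_ge0 //; apply: ler_sum => t _.
  by apply: (mean_le (hist_mean _ _ _)) => h ht; apply: fg => /=; split.
- rewrite /time_avg; under eq_bigr do rewrite (mean1 (hist_mean _ _ _)).
  by rewrite sumr_const card_ord mulVf.
Qed.

Definition hist_sum (F : nat -> profile 2 'I_m -> profile 2 (arm m) -> R)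
    (h : history 2 m) : R :=
  \sum_(r <- zip (iota 0 (size h)) h) F r.1 r.2.1 r.2.2.

Lemma hist_sum_nil F : hist_sum F [::] = 0.
Proof. by rewrite /hist_sum big_nil. Qed.

Lemma hist_sum_rcons F h v b :
  hist_sum F (rcons h (v, b)) = hist_sum F h + F (size h) v b.
Proof.
rewrite /hist_sum size_rcons -[(size h).+1]addn1 iotaD add0n /= cats1.
by rewrite zip_rcons ?size_iota // -cats1 big_cat big_seq1.
Qed.

Lemma hist_sum_mean F : history_exp A S T (hist_sum F) =
  \sum_(t < T) history_exp A S t (fun h => round_exp A S h (F t)).
Proof.
have := hist_telescope A S T (hist_sum F); rewrite hist_sum_nil subr0 => <-.
apply: eq_bigr => t _; apply: (mean_eq (hist_mean A S t)) => h ht.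
congr round_exp; apply/funext => v; apply/funext => b.
by rewrite hist_sum_rcons ht addrC addKr.
Qed.

(* The sum of squares is at most B^2 T on average, as the increments are centered,
   and 2 |z| <= z^2 / lam + lam. *)
Lemma hist_sum_abs k (xi : nat -> 'I_m -> R) (B lam : R) :
  (forall t, val_exp (D := D) (xi t) = 0) -> (forall t v, `|xi t v| <= B) -> 0 < lam ->
  history_exp A S T (fun h => `|hist_sum (fun t v _ => xi t (v (rival k))) h|) <=
  (B ^+ 2 * T%:R / lam + lam) / 2.
Proof.
move=> xi0 xiB lam0; set Z := hist_sum _; have mh := hist_mean A S T.
have Z2 : history_exp A S T (fun h => Z h ^+ 2) <= B ^+ 2 * T%:R.
  have := hist_telescope A S T (fun h => Z h ^+ 2).
  have -> : Z [::] = 0 by exact: hist_sum_nil.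
  rewrite expr0n subr0 => <-.
  rewrite -[X in _ * X%:R]card_ord mulr_natr -sumr_const; apply: ler_sum => t _.
  apply: (mean_leC (hist_mean A S t)) => h ht.
  have -> : round_exp A S h (fun v b => Z (rcons h (v, b)) ^+ 2 - Z h ^+ 2) =
    rival_exp A S h k (fun z => 2 * Z h * xi t z.1 + xi t z.1 ^+ 2).
    rewrite -round_rival; congr round_exp; apply/funext => v; apply/funext => b /=.
    by rewrite /Z hist_sum_rcons ht; ring.
  have mr := rival_mean A S h k; rewrite (meanD mr) (meanZ mr).
  rewrite rival_value xi0 mulr0 add0r; apply: (mean_leC mr) => z _.
  by rewrite -real_normK ?num_real // ler_sqr ?nnegrE ?(le_trans _ (xiB t z.1)).
apply: (@le_trans _ _ (history_exp A S T (fun h => (lam^-1 * Z h ^+ 2 + lam) / 2))).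
  apply: (mean_le mh) => h _; set q := lam^-1 * Z h ^+ 2.
  have qE : lam * q = `|Z h| ^+ 2 by rewrite /q mulrA divff ?gt_eqF // mul1r real_normK ?num_real.
  have : 0 <= lam * (q + lam - 2 * `|Z h|).
    by have := sqr_ge0 (`|Z h| - lam); rewrite mulrBr mulrDr qE; lra.
  by rewrite pmulr_rge0 //; lra.
rewrite (meanZr mh) (meanD mh) (meanZ mh) (mean_cst mh).
rewrite ler_pM2r // lerD2r mulrC ler_pM2r ?invr_gt0 //.
Qed.

End TimeAverage.

(** * Constraints on exponential weights in arbitrary auction sequences *)

Section Tradeoff.
Context {R : realType}.
Notation D := (@dist R).
Implicit Types (h : history 2 3) (i k : 'I_2) (b c : arm 3).

Variables (A : nat -> auction 2 D) (S : 'I_2 -> strategy R 3) (eta : R) (T : nat).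
Hypotheses (eta_gt0 : 0 < eta) (T_gt0 : (0 < T)%N).
Hypothesis S_hedge : forall i, S i = hedge (D := D) eta.

Let av := time_avg A S T.
Let rav i (f : nat -> arm 3 -> R) :=
  av (fun th => rival_exp A S th.2 i (fun z => f th.1 z.2)).
Let av_mean := time_avg_mean A S T_gt0.

(** Only the high value is tracked: the low value always pulls [lo], and the middle value is
    rare. *)
Definition freq k b : R := av (fun th => act A S th.2 k hi b).

Lemma act_supp h k j b : 0 < act A S h k j b -> exists2 v, b = Some v & (v <= j)%N.
Proof. by rewrite /act S_hedge; exact: hedge_support. Qed.

Lemma act_lo h k (G : arm 3 -> R) : wexp (act A S h k lo) G = G (Some lo).
Proof.
have ml := lot_mean (act A S h k lo).
rewrite -[RHS](mean_cst ml); apply: (mean_eq ml) => b /act_supp[v ->].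
by rewrite leqn0 => /eqP v0; congr (G (Some _)); apply/val_inj.
Qed.

Lemma Y_avgE i j : Y_avg A S T i j = rav i (fun t c => al (A t) i (Some j) c).
Proof.
rewrite /Y_avg total_atE; congr (_ * _); apply: eq_bigr => t _ /=.
congr history_exp; apply/funext => h.
rewrite -[RHS](mean_cst (lot_mean (act A S h i j))); congr wexp; apply/funext => b.
by congr rival_exp; apply/funext => z; rewrite upd_duo.
Qed.

Lemma X_avgE i j : X_avg A S T i j = av (fun th => wexp (act A S th.2 i j)
  (fun b => rival_exp A S th.2 i (fun z => al (A th.1) i b z.2))).
Proof. by rewrite /X_avg total_atE. Qed.

Lemma U_avgE i j : U_avg A S T i j = av (fun th => wexp (act A S th.2 i j)
  (fun b => rival_exp A S th.2 i (fun z => rew (A th.1) i j b z.2))).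
Proof. by rewrite /U_avg total_atE. Qed.

(** Against a rival on the top arm, the top arm only ties and wins at most 1/2; this is weighted by
    the probability 49/100 of a high rival. *)
Lemma Y_hi_le i : Y_avg A S T i hi <= 1 - 49/200 * freq (rival i) (Some hi).
Proof.
rewrite Y_avgE -[X in X - _](mean_cst av_mean) -(meanZ av_mean) -(meanB av_mean).
apply: (mean_le av_mean) => -[t h] _ /=; have mr := rival_mean A S h i.
apply: (@le_trans _ _ (rival_exp A S h i (fun z => 1 - 1/2 * (z.2 == Some hi)%:R))).
  apply: (mean_le mr) => z _; case: eqP => [->|_] /=; last first.
    by rewrite mulr0 subr0 al_le1.
  by have := al_tie (A t) i (Some hi); rewrite mulr1; lra.
rewrite (meanB mr) (mean_cst mr) (meanZ mr) /rival_exp val_exp3 !wexp_delta.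
have := pull_prob_ge0 (act A S h (rival i) lo) (Some hi).
have := pull_prob_ge0 (act A S h (rival i) mid) (Some hi).
lra.
Qed.

(** Two high buyers share at most one item, and against the two other values each wins at most 1:
    49/100 + 2 (1/2 + 1/100) = 151/100. A high buyer on [lo] ties with low rivals, which loses 1/2
    with probability 1/2. *)
Lemma X_hi_le i : X_avg A S T i hi + X_avg A S T (rival i) hi <=
  151/100 - 1/4 * (freq i (Some lo) + freq (rival i) (Some lo)).
Proof.
rewrite !X_avgE -(meanD av_mean) -[X in X - _](mean_cst av_mean) -(meanD av_mean).
rewrite -(meanZ av_mean) -(meanB av_mean); apply: (mean_le av_mean) => -[t h] _ /=.
pose l k := act A S h k hi.
pose duel_hi k := wexp (l k) (fun b => wexp (l (rival k)) (fun c => al (A t) k b c)).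
have one k : wexp (l k) (fun b => rival_exp A S h k (fun z => al (A t) k b z.2)) <=
    1/2 * (1 - 1/2 * l k (Some lo)) + 1/100 + 49/100 * duel_hi k.
  have ml := lot_mean (l k).
  rewrite -[X in 1 - _ * X]wexp_delta -(meanZ ml) -[X in X - _](mean_cst ml) -(meanB ml).
  rewrite -(meanZ ml) -(meanZ ml) -[X in _ + X + _](mean_cst ml) -!(meanD ml).
  apply: (mean_le ml) => b _; rewrite /rival_exp val_exp3 act_lo.
  rewrite lerD2r lerD //.
    rewrite ler_pM2l; last by lra.
    case: eqVneq => [->|_] /=; last by rewrite mulr0 subr0 al_le1.
    by have := al_tie (A t) k (Some lo); rewrite mulr1; lra.
  apply: ler_piMr; first by lra.
  by apply: (mean_leC (lot_mean _)) => c _; exact: al_le1.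
have : duel_hi i + duel_hi (rival i) <= 1.
  rewrite /duel_hi rivalK [X in _ + X]wexp_swap -(meanD (lot_mean (l i))).
  apply: (mean_leC (lot_mean _)) => b _; rewrite -(meanD (lot_mean (l (rival i)))).
  by apply: (mean_leC (lot_mean _)) => c _; exact: al_sum.
by have := one i; have := one (rival i); rewrite /l; lra.
Qed.

Definition mid_price i : R := rav i (fun t c => pay (A t) i (Some mid) c).

(** The left side is the average payment of a high value. By monotonicity the arms [lo] and [mid]
    cost at most the price of [mid], and the top arm costs at most 6. *)
Lemma payment_hi_le i :
  6 * X_avg A S T i hi - U_avg A S T i hi <= mid_price i + 6 * freq i (Some hi).
Proof.
rewrite X_avgE U_avgE -!(meanZ av_mean) -(meanB av_mean) -(meanD av_mean).
apply: (mean_le av_mean) => -[t h] _ /=; have mr := rival_mean A S h i.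
have ml := lot_mean (act A S h i hi); rewrite -wexp_delta -!(meanZ ml) -(meanB ml).
rewrite -[X in X + _](mean_cst ml) -(meanD ml); apply: (mean_le ml) => b bS.
rewrite -(meanZ mr) -(meanB mr) -[X in _ + X](mean_cst mr) -(meanD mr).
apply: (mean_le mr) => z _.
have -> : 6 * al (A t) i b z.2 - rew (A t) i hi b z.2 = pay (A t) i b z.2.
  by rewrite /rew /= /dist_val /=; lra.
case: (act_supp bS) => v -> _; elim/ord3P: v.
- by rewrite mulr0 addr0 pay_mono.
- by rewrite mulr0 addr0.
- rewrite eqxx mulr1 (le_trans (pay_le _ _ _ _)) //= /dist_val /=.
  by have := al_le1 (A t) i (Some hi) z.2; have := pay_ge0 (A t) i (Some mid) z.2; lra.
Qed.

Lemma cum_avg i b j : T%:R^-1 * history_exp A S T (fun h => cum A i h b j) =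
  rav i (fun t c => rew (A t) i j b c).
Proof. by rewrite hist_cum. Qed.

Lemma cum_lo_le i :
  T%:R^-1 * history_exp A S T (fun h => cum A i h (Some lo) mid) <=
  2 * Y_avg A S T i lo.
Proof.
rewrite cum_avg Y_avgE -(meanZ av_mean); apply: (mean_le av_mean) => -[t h] _ /=.
have mr := rival_mean A S h i; rewrite -(meanZ mr); apply: (mean_le mr) => z _.
by rewrite /rew /= /dist_val /= gerBl pay_ge0.
Qed.

Lemma cum_midE i :
  T%:R^-1 * history_exp A S T (fun h => cum A i h (Some mid) mid) =
  2 * Y_avg A S T i mid - mid_price i.
Proof.
rewrite cum_avg Y_avgE -(meanZ av_mean) -(meanB av_mean).
apply: (mean_eq av_mean) => -[t h] _ /=.
by have mr := rival_mean A S h i; rewrite -(meanZ mr) -(meanB mr).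
Qed.

Let cum_max i h := Num.max (cum A i h (Some lo) mid) (cum A i h (Some mid) mid).

(** At the middle value just two arms carry weight. The potential starts at ln 2 and ends at most at
    ln 2 + eta [cum_max], so the ln 2 cancels and no error term remains. *)
Lemma U_mid_le i : U_avg A S T i mid <= T%:R^-1 * history_exp A S T (cum_max i).
Proof.
rewrite /U_avg -/(utility_at A S T i mid) ler_pM2l ?invr_gt0 ?ltr0n //.
rewrite -(ler_pM2l eta_gt0).
have mh := hist_mean A S T; rewrite -(meanZ mh).
have := @hedge_utility_le _ _ _ eta A S i mid (S_hedge i) T.
move/le_trans; apply; rewrite lerBlDr -[X in _ <= _ + X](mean_cst mh) -(meanD mh).
have sum_mid o : hedge_total (D := D) eta o mid =
    expR (eta * cumulative_utility D o (Some lo) mid) +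
    expR (eta * cumulative_utility D o (Some mid) mid).
  rewrite /hedge_total (bigD1 None) //= add0r (bigD1 (Some lo)) //= (bigD1 (Some mid)) //=.
  rewrite big1 ?addr0 // => -[k|//]; elim/ord3P: k => //=.
apply: (mean_le mh) => h _; rewrite /hedge_pot !sum_mid.
rewrite -!/(cum _ _ _ _ _) !cum_nil !mulr0 expR0 -[X in _ <= X + _]expRK.
rewrite -lnM ?posrE ?expR_gt0 ?addr_gt0 // ler_ln ?posrE ?mulr_gt0 ?addr_gt0 ?expR_gt0 //.
have le1 : expR (eta * cum A i h (Some lo) mid) <= expR (eta * cum_max i h).
  by rewrite ler_expR ler_pM2l // le_max lexx.
have le2 : expR (eta * cum A i h (Some mid) mid) <= expR (eta * cum_max i h).
  by rewrite ler_expR ler_pM2l // le_max lexx orbT.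
by rewrite mulrDr mulr1 lerD.
Qed.

(** * Concentration of the utilities in hindsight *)

Section Concentration.
Variable i : 'I_2.
Let k := rival i.

Let gain t c := rew (A t) i mid (Some mid) c - rew (A t) i mid (Some lo) c.

Lemma gain_bound t c : `|gain t c| <= 2.
Proof.
have v2 : D mid = 2 by [].
have r1 := rew_le (A t) i mid (Some mid) c; have r2 := rew_le (A t) i mid (Some lo) c.
have r3 : 0 <= rew (A t) i mid (Some mid) c by exact: rew_ge0.
have r4 : 0 <= rew (A t) i mid (Some lo) c by apply: rew_ge0; rewrite /= /dist_val /=; lra.
by rewrite ler_norml /gain; move: r1 r2; rewrite v2; lra.
Qed.

(* The rival plays [play_lo] except for mid values, which are rare, and for the few
   rounds in which a high value does not pull [mid]. *)
Let typical t v := gain t (play_lo v).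
Let drift t := val_exp (D := D) (typical t).
Let noise t v := typical t v - drift t.

Lemma noise_mean t : val_exp (D := D) (noise t) = 0.
Proof. by rewrite (meanB val_mean) (mean_cst val_mean) subrr. Qed.

Lemma noise_bound t v : `|noise t v| <= 4.
Proof.
have h1 : `|drift t| <= 2.
  rewrite (le_trans (mean_norm val_mean _)) //.
  by apply: (mean_leC val_mean) => w _; exact: gain_bound.
rewrite (le_trans (ler_normB _ _)) //; have := gain_bound t (play_lo v).
by rewrite /typical; lra.
Qed.

Let Z := hist_sum (fun t v (_ : profile 2 (arm 3)) => noise t (v k)).
Let W := hist_sum (fun t v (b : profile 2 (arm 3)) => `|gain t (b k) - typical t (v k)|).

(** The lead of [mid] over [lo] splits into centered noise [Z], a drift determined by the auctions
    alone, and the effect of the rival's deviations from [play_lo], which [W] controls. *)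
Lemma cum_gain h : `|cum A i h (Some mid) mid - cum A i h (Some lo) mid
  - Z h - \sum_(t < size h) drift t| <= W h.
Proof.
elim/last_ind: h => [|h [v b] ih].
  by rewrite !cum_nil /Z /W !hist_sum_nil big_ord0 !subr0 normr0.
rewrite !cum_rcons /Z /W !hist_sum_rcons size_rcons big_ord_recr /=.
rewrite -/(Z h) -/(W h) -/k; set c := b k.
rewrite (_ : _ - _ = (cum A i h (Some mid) mid - cum A i h (Some lo) mid
  - Z h - \sum_(t < size h) drift t) + (gain (size h) c - typical (size h) (v k))).
  by rewrite (le_trans (ler_normD _ _)) // lerD2r.
by rewrite /noise /gain; ring.
Qed.

Lemma Z_mean : history_exp A S T Z = 0.
Proof.
rewrite hist_sum_mean big1 // => t _.
rewrite -[RHS](mean_cst (hist_mean A S t)); apply: (mean_eq (hist_mean A S t)) => h _.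
rewrite (round_rival A S h i (fun z => noise t z.1)) rival_value noise_mean //.
Qed.

(** Low values follow [play_lo] exactly, middle values have probability 1/100, and high values
    deviate only by pulling [lo] or [hi]; a deviation costs at most 4. *)
Lemma W_le : T%:R^-1 * history_exp A S T W <=
  4 * (1/100 + 49/100 * (freq k (Some lo) + freq k (Some hi))).
Proof.
rewrite hist_sum_mean -[leLHS]/(av (fun th => round_exp A S th.2
  (fun v (b : profile 2 (arm 3)) => `|gain th.1 (b k) - typical th.1 (v k)|))).
rewrite -(meanD av_mean) -(meanZ av_mean) -[X in _ * (X + _)](mean_cst av_mean).
rewrite -(meanD av_mean) -(meanZ av_mean); apply: (mean_le av_mean) => -[t h] _ /=.
rewrite (round_rival A S h i (fun z => `|gain t z.2 - typical t z.1|)).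
have g4 b c : `|gain t b - gain t c| <= 4.
  rewrite (le_trans (ler_normB _ _)) //; have := gain_bound t b; have := gain_bound t c; lra.
rewrite /rival_exp val_exp3 /= /typical act_lo subrr normr0 mulr0 add0r.
have ml := lot_mean (act A S h (rival i) hi).
rewrite mulrDr lerD //.
  rewrite mulrC ler_pM2r; last by lra.
  by apply: (mean_leC (lot_mean _)) => c _; exact: g4.
rewrite mulrCA ler_pM2l; last by lra.
rewrite -!wexp_delta -(meanD ml) -(meanZ ml); apply: (mean_le ml) => c cS.
case: (act_supp cS) => v -> _; elim/ord3P: v.
- by rewrite (le_trans (g4 _ _)) //= addr0 mulr1.
- by rewrite subrr normr0 /= addr0 mulr0.
- by rewrite (le_trans (g4 _ _)) //= add0r mulr1.
Qed.

(** [U_mid_le] has the expectation of a maximum, and here the maximum of expectations is wanted. The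
    deterministic drift [G] mediates: replacing the lead by [G] and returning to its expectation
    each cost one [EW], whence 8 = 2 * 4. *)
Lemma U_mid_bound delta : 0 < delta -> U_avg A S T i mid <=
  Num.max (2 * Y_avg A S T i lo) (2 * Y_avg A S T i mid - mid_price i)
  + (8 / (delta * T%:R) + delta / 2)
  + 8 * (1/100 + 49/100 * (freq k (Some lo) + freq k (Some hi))).
Proof.
move=> delta0; have T0 : 0 < T%:R :> R by rewrite ltr0n.
have mh := hist_mean A S T; pose G := \sum_(t < T) drift t.
(* With this [lam] and noise bound 4, the noise per round is at most 8 / (delta T) + delta / 2. *)
have lam0 : 0 < delta * T%:R by rewrite mulr_gt0.
have Zabs := hist_sum_abs A S T i noise_mean noise_bound lam0.
rewrite -/Z in Zabs.
pose clo := history_exp A S T (fun h => cum A i h (Some lo) mid).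
pose cmid := history_exp A S T (fun h => cum A i h (Some mid) mid).
pose EW := history_exp A S T W.
have GW : G <= cmid - clo + EW.
  have -> : cmid - clo + EW = history_exp A S T (fun h =>
      cum A i h (Some mid) mid - cum A i h (Some lo) mid - Z h + W h).
    by rewrite (meanD mh) !(meanB mh) Z_mean subr0.
  apply: (mean_geC mh) => h hT; have := cum_gain h.
  by rewrite ler_norml hT -/G => /andP[+ _]; lra.
have Emax : history_exp A S T (cum_max i) <=
    clo + Num.max 0 G + history_exp A S T (fun h => `|Z h|) + EW.
  rewrite -[X in _ + X + _ + _](mean_cst mh) -!(meanD mh); apply: (mean_le mh) => h hT.
  have := cum_gain h; rewrite hT -/G ler_norml => /andP[_ gapW].
  have := ler_norm (Z h); have := normr_ge0 (Z h).
  have W0 : 0 <= W h by rewrite (le_trans _ (cum_gain h)).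
  have : G <= Num.max 0 G by rewrite le_max lexx orbT.
  have : 0 <= Num.max 0 G by rewrite le_max lexx.
  by rewrite /cum_max ge_max => *; apply/andP; split; lra.
have maxG : clo + Num.max 0 G <= Num.max clo cmid + EW.
  have W0 : 0 <= EW by apply: (mean_ge0 mh) => h _; rewrite (le_trans _ (cum_gain h)).
  have : clo <= Num.max clo cmid by rewrite le_max lexx.
  have : cmid <= Num.max clo cmid by rewrite le_max lexx orbT.
  by case: (leP 0 G); lra.
rewrite (le_trans (U_mid_le i)) //.
have total : history_exp A S T (cum_max i) <=
    Num.max clo cmid + (4 ^+ 2 * T%:R / (delta * T%:R) + delta * T%:R) / 2 + 2 * EW.
  by move: Emax maxG Zabs; lra.
apply: (@le_trans _ _ (T%:R^-1 * (Num.max clo cmid +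
  (4 ^+ 2 * T%:R / (delta * T%:R) + delta * T%:R) / 2 + 2 * EW))).
  by rewrite ler_pM2l ?invr_gt0.
rewrite 2!mulrDr lerD ?lerD //.
- rewrite maxr_pMr ?invr_ge0 // -cum_midE.
  by rewrite ge_max !le_max cum_lo_le lexx orbT.
- rewrite le_eqVlt; apply/orP; left; apply/eqP; field.
  by rewrite gt_eqF //= gt_eqF.
- by rewrite mulrCA; have := W_le; rewrite -/EW; lra.
Qed.

End Concentration.

End Tradeoff.

(** * Infeasibility of the midpoint *)

Section Midpoint.
Context {R : realType}.
Notation D := (@dist R).

Lemma O_rate_small (f : nat -> R) e : f =O_\oo rate -> 0 < e ->
  \forall T \near \oo, `|f T| <= e.
Proof.
move=> /eqO_exP[k k0 fk] e0; near=> T.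
have : `|f T| <= k * `|rate T| by near: T.
move/le_trans; apply; rewrite gtr0_norm ?rate_gt0 // -ler_pdivlMl // mulrC.
by near: T; apply: rate_near; rewrite divr_gt0.
Unshelve. all: by end_near.
Qed.

(** Without errors the price [P] of [mid] is at least 6 * 301/400 - 94/25 = 0.755, so [lo] gives a
    middle value at most 0.505 and [mid] at most 0.75, against the required 1.005. All error terms
    together stay below the margin 0.255. *)
Lemma midpoint_arith (Xi Xk Ylo Ymid Yi Yk Umid Uhi P Ni Nk Mi Mk w : R) :
  301/400 - 1/2000 <= Xi -> 301/400 - 1/2000 <= Xk ->
  Ylo <= 101/400 + 1/2000 -> Ymid <= 301/400 + 1/2000 ->
  1 - 1/2000 <= Yi -> 1 - 1/2000 <= Yk ->
  201/200 - 1/2000 <= Umid -> Uhi <= 94/25 + 1/2000 ->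
  Yi <= 1 - 49/200 * Nk -> Yk <= 1 - 49/200 * Ni ->
  Xi + Xk <= 151/100 - 1/4 * (Mi + Mk) -> 0 <= Mi ->
  6 * Xi - Uhi <= P + 6 * Ni -> w <= 1/40 ->
  Umid <= Num.max (2 * Ylo) (2 * Ymid - P) + (w + 1/20 / 2) +
    8 * (1/100 + 49/100 * (Mk + Nk)) -> False.
Proof. by case: (leP (2 * Ylo) (2 * Ymid - P)) => _ *; lra. Qed.

(** Feasibility must hold for all clever strategies, so it is tested on exponential weights with
    gamma = [rate]. The prescribed coordinates are those of the midpoint that enter
    [midpoint_arith]. *)
Lemma midpoint_infeasible (A : nat -> nat -> auction 2 D) (x y u : 'rV[R]_3) :
  x ord0 hi = 301/400 -> y ord0 lo = 101/400 -> y ord0 mid = 301/400 ->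
  y ord0 hi = 1 -> u ord0 mid = 201/200 -> u ord0 hi = 94/25 ->
  ~ auction_feasible_via A x y u.
Proof.
move=> x2 y0 y1 y2 u1 u2 feas.
pose S (_ : 'I_2) T : strategy R 3 := hedge (D := D) (rate T ^+ 2).
have avg i j := feas _ rate_gt0 rate_cvg0 S (fun i => hedge_clever i) i j.
pose e : R := 1/2000; have e0 : 0 < e by rewrite /e; lra.
have near_X i j : \forall T \near \oo,
    x ord0 j - e <= X_avg (A T) (S ^~ T) T i j <= x ord0 j + e.
  have [XO _ _] := avg i j; apply: filterS (O_rate_small XO e0) => T.
  by rewrite ler_distl.
have near_Y i j : \forall T \near \oo,
    y ord0 j - e <= Y_avg (A T) (S ^~ T) T i j <= y ord0 j + e.
  have [_ YO _] := avg i j; apply: filterS (O_rate_small YO e0) => T.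
  by rewrite ler_distl.
have near_U i j : \forall T \near \oo,
    u ord0 j - e <= U_avg (A T) (S ^~ T) T i j <= u ord0 j + e.
  have [_ _ UO] := avg i j; apply: filterS (O_rate_small UO e0) => T.
  by rewrite ler_distl.
pose i : 'I_2 := ord0; pose k := rival i.
have delta0 : 0 < 1/20 :> R by lra.
have near_w : \forall T \near \oo, (0 < T)%N /\ 8 / (1/20 * T%:R) <= 1/40 :> R.
  (* With delta = 1/20 the term 8 / (delta T) is 160 / T, which is at most 1/40 from T = 6400 on. *)
  near=> T; have : 80 * 80 <= T%:R :> R by near: T; exact: nbhs_infty_ger.
  by split; [rewrite -(ltr0n R)|rewrite ler_pdivrMr]; lra.
near \oo => T.
have [T_gt0 w_le] : (0 < T)%N /\ 8 / (1/20 * T%:R) <= 1/40 :> R.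
  by near: T; exact: near_w.
have eta_gt0 : 0 < rate T ^+ 2 :> R by rewrite exprn_gt0 ?rate_gt0.
have hedgeS j : (S ^~ T) j = hedge (D := D) (rate T ^+ 2) by [].
have /andP[Xi _] : x ord0 hi - e <= X_avg (A T) (S ^~ T) T i hi <= x ord0 hi + e.
  by near: T; exact: near_X.
have /andP[Xk _] : x ord0 hi - e <= X_avg (A T) (S ^~ T) T k hi <= x ord0 hi + e.
  by near: T; exact: near_X.
have /andP[_ Ylo] : y ord0 lo - e <= Y_avg (A T) (S ^~ T) T i lo <= y ord0 lo + e.
  by near: T; exact: near_Y.
have /andP[_ Ymid] : y ord0 mid - e <= Y_avg (A T) (S ^~ T) T i mid <= y ord0 mid + e.
  by near: T; exact: near_Y.
have /andP[Yi _] : y ord0 hi - e <= Y_avg (A T) (S ^~ T) T i hi <= y ord0 hi + e.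
  by near: T; exact: near_Y.
have /andP[Yk _] : y ord0 hi - e <= Y_avg (A T) (S ^~ T) T k hi <= y ord0 hi + e.
  by near: T; exact: near_Y.
have /andP[Umid _] : u ord0 mid - e <= U_avg (A T) (S ^~ T) T i mid <= u ord0 mid + e.
  by near: T; exact: near_U.
have /andP[_ Uhi] : u ord0 hi - e <= U_avg (A T) (S ^~ T) T i hi <= u ord0 hi + e.
  by near: T; exact: near_U.
rewrite x2 in Xi Xk; rewrite y0 in Ylo; rewrite y1 in Ymid; rewrite y2 in Yi Yk.
rewrite u1 in Umid; rewrite u2 in Uhi.
have hi_i := Y_hi_le (A T) (S ^~ T) T_gt0 i.
have hi_k := Y_hi_le (A T) (S ^~ T) T_gt0 k; rewrite rivalK in hi_k.
have freq_ge0 : 0 <= freq (A T) (S ^~ T) T i (Some lo).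
  by apply: (mean_ge0 (time_avg_mean _ _ T_gt0)) => th _; exact: pull_prob_ge0.
exact: (midpoint_arith Xi Xk Ylo Ymid Yi Yk Umid Uhi hi_i hi_k
  (X_hi_le (A T) T_gt0 hedgeS i) freq_ge0 (payment_hi_le (A T) T_gt0 hedgeS i) w_le
  (U_mid_bound (A T) eta_gt0 T_gt0 hedgeS i delta0)).
Unshelve. all: by end_near.
Qed.

End Midpoint.

Theorem theorem22 (R : realType) :
  exists (m : nat) (D : value_dist R m),
    ~ convex_set (feasible_set 2 D).
Proof.
exists 3%N, dist => cvx.
have h0 : 0 <= 2^-1 :> R by lra.
have h1 : 2^-1 <= 1 :> R by lra.
(* Convexity is applied with weight 1/2; the remaining goals compute six coordinates of the
   midpoint. *)
have := cvx (outcome 0 play_mid) (outcome 2 play_lo) (Itv01 h0 h1)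
  (mem_set pooled_mid_feasible) (mem_set pooled_lo_feasible).
move/set_mem => [A]; apply: midpoint_infeasible.
all: rewrite /= !mxE !val_exp3 /= /ask /rank /dist_val /unstable.onem /=.
all: lra.
Qed.
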